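(* Let $C(D)^H$ be a Hopf Galois coextension. Then $C^D$ is a right-left stable anti Yetter-Drinfeld (SAYD) module over $H$ with the left $H$-coaction $$\triangledown^{C^D}: C^D\longrightarrow H\otimes C^D,\qquad c\longmapsto \kappa\big(\overline{c^{(3)}\,\square_D\, c^{(1)}}\big)\otimes c^{(2)},$$ and the right $H$-action $\blacktriangleleft: C^D\otimes H\to C^D$, $c\blacktriangleleft h = c\triangleleft h$, obtained by restricting the given action of $H$ on $C$.
   Context: Work over a ground field $k$; $\otimes=\otimes_k$. Sweedler notation (summation suppressed): $\Delta(c)=c^{(1)}\otimes c^{(2)}$; $\varepsilon$ denotes counits and $S$ the antipode of a Hopf algebra. Hopf Galois coextension. Let $H$ be a Hopf algebra and $C$ a right $H$-module coalgebra with action $\triangleleft: C\otimes H\to C$. The span $I$ of the elements $c\triangleleft h-\varepsilon(h)c$ is a two-sided coideal; put $D=C/I$, a coalgebra, with natural surjection $\pi:C\to D$. $C$ is a $D$-bicomodule by $c\mapsto \pi(c^{(1)})\otimes c^{(2)}$ and $c\mapsto c^{(1)}\otimes\pi(c^{(2)})$, and $C\,\square_D\,C$ is the corresponding cotensor product (the subspace of $C\otimes C$ of all $\sum c\otimes c'$ with $\sum c^{(1)}\otimes\pi(c^{(2)})\otimes c'=\sum c\otimes\pi(c'^{(1)})\otimes c'^{(2)}$). Its elements are written $c\,\square_D\,c'$ (or $c\otimes c'$), summation suppressed. $\pi:C\to D$ is a (right) Hopf Galois coextension, denoted $C(D)^H$, if the canonical map $\beta: C\otimes H\to C\,\square_D\,C$,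 $c\otimes h\mapsto c^{(1)}\otimes c^{(2)}\triangleleft h$, is bijective. Set $D^*=\mathrm{Hom}_k(D,k)$ and $$C^D=\{c\in C:\ c^{(1)}\varphi(\pi(c^{(2)}))=c^{(2)}\varphi(\pi(c^{(1)}))\ \text{for all }\varphi\in D^*\}.$$ Set $C_D=C/W$, where $W$ is the span of all $c^{(1)}\varphi(\pi(c^{(2)}))-c^{(2)}\varphi(\pi(c^{(1)}))$, $c\in C$, $\varphi\in D^*$. Set $(C\,\square_D\,C)_D=(C\,\square_D\,C)/W'$, where $W'$ is the span of all $c\otimes c'^{(1)}\varphi(\pi(c'^{(2)}))-c^{(2)}\otimes c'\varphi(\pi(c^{(1)}))$ with $c\otimes c'\in C\,\square_D\,C$, $\varphi\in D^*$. Classes are denoted by an overline. The map $\beta$ induces a bijection $\bar\beta:C_D\otimes H\to (C\,\square_D\,C)_D$, $\bar\beta(\bar c\otimes h)=\overline{\beta(c\otimes h)}$, and one defines $$\kappa=(\varepsilon\otimes \mathrm{Id}_H)\circ\bar\beta^{-1}:(C\,\square_D\,C)_D\to H,$$ where $\varepsilon$ denotes the map $C_D\to k$ induced by the counit of $C$. For $c\in C^D$, the element $c^{(2)}\otimes\overline{c^{(3)}\,\square_D\,c^{(1)}}$ is a well-defined element of $C^D\otimes (C\,\square_D\,C)_D$. A right-left SAYD module over $H$ is a right $H$-module $M$ (action $\triangleleft$) that is also a left $H$-comodule (coaction $m\mapsto m_{<-1>}\otimes m_{<0>}$) such that for all $m\in M,h\in H$ $$(m\triangleleft h)_{<-1>}\otimes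 (m\triangleleft h)_{<0>}=S(h^{(3)})m_{<-1>}h^{(1)}\otimes m_{<0>}\triangleleft h^{(2)}$$ (anti Yetter-Drinfeld condition) and $m_{<0>}\triangleleft m_{<-1>}=m$ (stability). *)

(* Defs.v *)
From HB Require Import structures.
From mathcomp Require Import all_boot all_order all_algebra.
From mathcomp Require Import generic_quotient ring_quotient.
From mathcomp Require Import boolp classical_sets.
From mathcomp Require Import freeg.

Set Implicit Arguments.
Unset Strict Implicit.
Unset Printing Implicit Defensive.

Import GRing.Theory.
Local Open Scope ring_scope.
Local Open Scope quotient_scope.

Section Span.
Variables (k : fieldType) (V : lmodType k).
Implicit Type S : set V.

Inductive spanned S : V -> Prop :=
| Spanned0 : spanned S 0
| SpannedDZ a u v : S u -> spanned S v -> spanned S (a *: u + v).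

Definition span S : {pred V} := fun v => `[< spanned S v >].

Lemma spanP S v : reflect (spanned S v) (v \in span S).
Proof. exact: asboolP. Qed.

Lemma span_gen S v : S v -> v \in span S.
Proof.
move=> Sv; apply/spanP; have := SpannedDZ 1 Sv (Spanned0 S).
by rewrite scale1r addr0.
Qed.

Lemma span_submod S : submod_closed (span S).
Proof.
split; first by apply/spanP; exact: Spanned0.
move=> a u v /spanP Su /spanP Sv; apply/spanP.
elim: Su => [|b w w' Sw _ IH]; first by rewrite scaler0 add0r.
by rewrite scalerDr scalerA -addrA; apply: SpannedDZ.
Qed.

HB.instance Definition _ S :=
  GRing.isSubmodClosed.Build k V (span S) (span_submod S).
End Span.

Section QuotientSpace.
Variables (k : fieldType) (V : lmodType k) (S : set V).

(* [S] need not be a subspace: this is V modulo the linear span of S. *)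
Definition qspace : Type := Quotient.quot (span S).
HB.instance Definition _ := GRing.Zmodule.on qspace.

Definition qclass (v : V) : qspace := \pi_(Quotient.quot (span S)) v.
Definition qrepr (q : qspace) : V := repr (q : Quotient.quot (span S)).

Lemma qreprK q : qclass (qrepr q) = q. Proof. exact: reprK. Qed.

Lemma qclass_eq u v : (qclass u = qclass v) <-> (u - v \in span S).
Proof.
rewrite /qclass Quotient.idealrBE.
by split=> [->|/eqP].
Qed.

Lemma qclassD : {morph qclass : u v / u + v}.
Proof. by move=> u v; rewrite /qclass !piE. Qed.

Definition qscale (a : k) (q : qspace) : qspace := qclass (a *: qrepr q).

Lemma qclassZ a v : qscale a (qclass v) = qclass (a *: v).
Proof.
by apply/qclass_eq; rewrite -scalerBr rpredZ //; apply/qclass_eq/qreprK.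
Qed.

Lemma qscaleA a b q : qscale a (qscale b q) = qscale (a * b) q.
Proof. by rewrite -(qreprK q) !qclassZ scalerA. Qed.
Lemma qscale1 : left_id 1 qscale.
Proof. by move=> q; rewrite -(qreprK q) qclassZ scale1r. Qed.
Lemma qscaleDr : right_distributive qscale +%R.
Proof.
move=> a p q; rewrite -(qreprK p) -(qreprK q).
by rewrite -qclassD !qclassZ scalerDr qclassD.
Qed.
Lemma qscaleDl q : {morph qscale^~ q : a b / a + b}.
Proof. by move=> a b; rewrite -(qreprK q) !qclassZ scalerDl qclassD. Qed.

HB.instance Definition _ :=
  GRing.Zmodule_isLmodule.Build k qspace qscaleA qscale1 qscaleDr qscaleDl.

Lemma qclass_linear : linear qclass.
Proof. by move=> a u v; rewrite qclassD -qclassZ. Qed.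
HB.instance Definition _ := GRing.isLinear.Build k V qspace *:%R
    qclass qclass_linear.

(* The map induced by [f] on classes; see [qliftE] for when this makes sense. *)
Definition qlift (U : Type) (f : V -> U) (q : qspace) : U := f (qrepr q).

Lemma qliftE (U : lmodType k) (f : V -> U) v :
  linear f -> (forall s, S s -> f s = 0) -> qlift f (qclass v) = f v.
Proof.
move=> lf fS; pose F : {linear V -> U} := HB.pack f (GRing.isLinear.Build _ _ _ _ f lf).
apply/eqP; rewrite -subr_eq0 -[f]/(F : V -> U) /qlift -linearB; apply/eqP.
have /qclass_eq/spanP : qclass (qrepr (qclass v)) = qclass v by exact: qreprK.
elim=> [|a u w Su _ IH]; first exact: linear0.
by rewrite linearP IH addr0 [F u]fS // scaler0.
Qed.

Lemma qlift_linear (U : lmodType k) (f : V -> U) :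
  linear f -> (forall s, S s -> f s = 0) -> linear (qlift f).
Proof.
move=> lf f0 a p q; rewrite -(qreprK p) -(qreprK q) -qclass_linear.
by rewrite !qliftE // lf.
Qed.
End QuotientSpace.
Arguments qclass {k V S} v.

Section FreeLift.
Variables (k : fieldType) (K : choiceType) (U : lmodType k) (f : K -> U).

Lemma fglift_linear : linear (fglift f : {freeg K / k} -> U).
Proof.
pose g := fglift f : {freeg K / k} -> U.
have gB : {morph g : x y / x - y} := lift_is_additive f.
have g0 : g 0 = 0 by rewrite -[X in g X](subr0 0) gB subrr.
have gN x : g (- x) = - g x by rewrite -[- x]add0r gB g0 add0r.
have gD : {morph g : x y / x + y}.
  by move=> x y; rewrite -[y in LHS]opprK gB gN opprK.
move=> a x y; rewrite -/g gD; congr (_ + _).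
rewrite -[a *: x]/(fgscale a x) -[in RHS](freeg_sumE x) /fgscale.
rewrite !(big_morph g gD g0) scaler_sumr.
by apply: eq_bigr => i _; rewrite /g !liftU scalerA.
Qed.

HB.instance Definition _ :=
  GRing.isLinear.Build k {freeg K / k} U *:%R (fglift f) fglift_linear.
End FreeLift.

Section Tensor.
Variables (k : fieldType) (V W : lmodType k).

Definition tensor_rel : set {freeg (V * W) / k} :=
  [set x | (exists a v v' w,
              x = << (a *: v + v', w) >> - (a *: << (v, w) >> + << (v', w) >>)) \/
           (exists a v w w',
              x = << (v, a *: w + w') >> - (a *: << (v, w) >> + << (v, w') >>))].

Definition tensor : Type := qspace tensor_rel.
HB.instance Definition _ := GRing.Lmodule.on tensor.

Definition tens (v : V) (w : W) : tensor := qclass << (v, w) >>.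

(* [tlift f] is the map v (x) w |-> f v w, and underlies the Sweedler notation
   below. It is the linear map induced by [f] exactly when [f] is bilinear,
   cf. [tlift_tens] and [tlift_linear]. *)
Definition tlift (U : lmodType k) (f : V -> W -> U) : tensor -> U :=
  qlift (fglift (fun p => f p.1 p.2)).

Definition bilin (U : lmodType k) (f : V -> W -> U) : Prop :=
  (forall v, linear (f v)) /\ (forall w, linear (f^~ w)).

Lemma fglift_rel0 (U : lmodType k) (f : V -> W -> U) :
  bilin f -> forall s, tensor_rel s -> fglift (fun p => f p.1 p.2) s = 0.
Proof.
move=> [fl fr] s.
case=> [[a [v [v' [w ->]]]]|[a [v [w [w' ->]]]]];
  rewrite linearB linearP /= !liftU /= !scale1r.
- by rewrite fr subrr.
- by rewrite fl subrr.
Qed.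

Lemma tlift_linear (U : lmodType k) (f : V -> W -> U) :
  bilin f -> linear (tlift f).
Proof.
move=> fB a x y; rewrite -(qreprK x) -(qreprK y).
rewrite -(linearP (@qclass k _ tensor_rel)).
rewrite /tlift !qliftE ?linearP //; try exact: fglift_rel0; exact: linearP.
Qed.

Lemma tlift_tens (U : lmodType k) (f : V -> W -> U) v w :
  bilin f -> tlift f (tens v w) = f v w.
Proof.
move=> fB; rewrite /tlift qliftE.
- by rewrite liftU scale1r.
- exact: linearP.
- exact: fglift_rel0.
Qed.

Lemma tlift_sum (U : lmodType k) (f : V -> W -> U) t :
  tlift f t = \sum_(p <- dom (qrepr t)) coeff p (qrepr t) *: f p.1 p.2.
Proof.
rewrite /tlift /qlift -[in LHS](freeg_sumE (qrepr t)) linear_sum.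
by apply: eq_bigr => p _; rewrite /= liftU.
Qed.

Lemma tlift_comp (U U' : lmodType k) (g : U -> U') (f : V -> W -> U) t :
  linear g -> g (tlift f t) = tlift (fun v w => g (f v w)) t.
Proof.
move=> lg; pose G : {linear U -> U'} := HB.pack g (GRing.isLinear.Build _ _ _ _ g lg).
rewrite !tlift_sum -[g]/(G : U -> U') linear_sum.
by apply: eq_bigr => p _; rewrite linearZ.
Qed.

Lemma tlift_linearl (U : lmodType k) a (f g : V -> W -> U) t :
  tlift (fun v w => a *: f v w + g v w) t = a *: tlift f t + tlift g t.
Proof.
rewrite !tlift_sum scaler_sumr -big_split; apply: eq_bigr => p _ /=.
by rewrite scalerDr !scalerA mulrC.
Qed.

Lemma eq_tlift (U : lmodType k) (f g : V -> W -> U) t :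
  (forall v w, f v w = g v w) -> tlift f t = tlift g t.
Proof. by move=> fg; rewrite !tlift_sum; apply: eq_bigr => p _; rewrite fg. Qed.

Lemma tens_bilin : bilin tens.
Proof.
split=> [v a w w'|w a v v']; rewrite /tens -linearP; apply/qclass_eq/span_gen.
  by right; exists a, v, w, w'.
by left; exists a, v, v', w.
Qed.

Lemma tlift_id t : tlift tens t = t.
Proof.
rewrite -[RHS]qreprK -[in RHS](freeg_sumE (qrepr t)) linear_sum tlift_sum.
apply: eq_bigr => p _; rewrite -linearZ /=; congr qclass.
apply/eqP/freeg_eqP => q; rewrite coeffZ !coeffU mul1r.
by case: p.
Qed.

Lemma tensor_ext (U : lmodType k) (f g : tensor -> U) :
  linear f -> linear g -> (forall v w, f (tens v w) = g (tens v w)) -> f =1 g.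
Proof.
move=> fl gl fg t; rewrite -(tlift_id t) !tlift_comp //.
exact: eq_tlift.
Qed.
End Tensor.

Notation "V ⊗ W" := (tensor V W) (at level 45, right associativity) : type_scope.
Notation "v ⊗ w" := (tens v w) (at level 45, right associativity) : ring_scope.
(* Sweedler notation: for t = \sum_i v_i (x) w_i, [tlet v ⊗ w := t in E v w] is
   \sum_i E v_i w_i. The body is always bilinear in v and w below. *)
Notation "'tlet' v ⊗ w := t 'in' E" := (tlift (fun v w => E) t)
  (at level 200, v name, w name, t at level 100, E at level 200,
   format "'[hv' 'tlet'  v  ⊗  w  :=  t  'in'  '/' E ']'") : ring_scope.

HB.mixin Record isCoalgebra (k : fieldType) C of GRing.Lmodule k C := {
  comul : C -> C ⊗ C;
  counit : C -> k;
  comul_linear : linear comul;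
  counit_linear : scalar counit;
  comulA : forall c,
    (tlet a ⊗ b := comul c in tlet a1 ⊗ a2 := comul a in a1 ⊗ a2 ⊗ b) =
    (tlet a ⊗ b := comul c in a ⊗ comul b);
  counitl : forall c, (tlet a ⊗ b := comul c in counit a *: b) = c;
  counitr : forall c, (tlet a ⊗ b := comul c in counit b *: a) = c
}.
#[short(type="coalgType")]
HB.structure Definition Coalgebra (k : fieldType) :=
  {C of GRing.Lmodule k C & isCoalgebra k C}.

HB.mixin Record isHopfAlgebra (k : fieldType) H
    of GRing.Algebra k H & isCoalgebra k H := {
  antipode : H -> H;
  comul1 : comul (1 : H) = (1 : H) ⊗ (1 : H);
  comulM : forall x y : H, comul (x * y) =
    (tlet x1 ⊗ x2 := comul x in tlet y1 ⊗ y2 := comul y in (x1 * y1) ⊗ (x2 * y2));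
  counit1 : counit (1 : H) = 1;
  counitM : {morph (counit : H -> k) : x y / x * y};
  antipode_linear : linear antipode;
  antipodel : forall x : H,
    (tlet a ⊗ b := comul x in antipode a * b) = counit x *: 1;
  antipoder : forall x : H,
    (tlet a ⊗ b := comul x in a * antipode b) = counit x *: 1
}.
#[short(type="hopfAlgType")]
HB.structure Definition HopfAlgebra (k : fieldType) :=
  {H of GRing.Algebra k H & isCoalgebra k H & isHopfAlgebra k H}.

Record right_module (k : fieldType) (H : algType k) (M : lmodType k)
    (act : M -> H -> M) : Prop := RightModule {
  rmod_bilin : bilin act;
  rmod1 : forall m, act m 1 = m;
  rmodM : forall m g h, act m (g * h) = act (act m g) h
}.

Record left_comodule (k : fieldType) (H : coalgType k) (M : lmodType k)
    (rho : M -> H ⊗ M) : Prop := LeftComodule {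
  lcomod_linear : linear rho;
  lcomodA : forall m,
    (tlet h ⊗ n := rho m in tlet h1 ⊗ h2 := comul h in h1 ⊗ h2 ⊗ n) =
    (tlet h ⊗ n := rho m in h ⊗ rho n);
  lcomod_counit : forall m, (tlet h ⊗ n := rho m in counit h *: n) = m
}.

(* Right-left stable anti Yetter-Drinfeld module. *)
Record SAYD (k : fieldType) (H : hopfAlgType k) (M : lmodType k)
    (act : M -> H -> M) (rho : M -> H ⊗ M) : Prop := IsSAYD {
  SAYD_module : right_module act;
  SAYD_comodule : left_comodule rho;
  SAYD_AYD : forall m h, rho (act m h) =
    (tlet h1 ⊗ h23 := comul h in tlet h2 ⊗ h3 := comul h23 in
     tlet g ⊗ n := rho m in (antipode h3 * g * h1) ⊗ act n h2);
  SAYD_stable : forall m, (tlet g ⊗ n := rho m in act n g) = m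
}.

HB.mixin Record isModuleCoalgebra (k : fieldType) (H : hopfAlgType k) C
    of GRing.Lmodule k C & isCoalgebra k C := {
  ract : C -> H -> C;
  ract_module : right_module ract;
  comul_ract : forall c h, comul (ract c h) =
    (tlet c1 ⊗ c2 := comul c in tlet h1 ⊗ h2 := comul h in
     ract c1 h1 ⊗ ract c2 h2);
  counit_ract : forall c h, counit (ract c h) = counit c * counit h
}.
#[short(type="modCoalgType")]
HB.structure Definition ModuleCoalgebra (k : fieldType) (H : hopfAlgType k) :=
  {C of GRing.Lmodule k C & isCoalgebra k C & isModuleCoalgebra k H C}.

Notation "c ◁ h" := (ract c h) (at level 40, left associativity) : ring_scope.

HB.instance Definition _ (k : fieldType) (C : coalgType k) :=
  GRing.isLinear.Build k C (C ⊗ C)%type *:%R (@comul k C) comul_linear.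
HB.instance Definition _ (k : fieldType) (C : coalgType k) :=
  GRing.isLinear.Build k C k *%R (@counit k C) counit_linear.

Section LinearComb.
Variables (k : fieldType) (U V W X : lmodType k).

Lemma lin_id : linear (fun x : U => x).
Proof. by []. Qed.
Lemma lin_comp (f : V -> W) (g : U -> V) :
  linear f -> linear g -> linear (fun x => f (g x)).
Proof. by move=> fl gl a x y; rewrite gl fl. Qed.
Lemma lin_bill (f : V -> W -> X) (g : U -> V) w :
  bilin f -> linear g -> linear (fun x => f (g x) w).
Proof. by move=> [_ fl] gl a x y; rewrite gl fl. Qed.
Lemma lin_bilr (f : V -> W -> X) (g : U -> W) v :
  bilin f -> linear g -> linear (fun x => f v (g x)).
Proof. by move=> [fl _] gl a x y; rewrite gl fl. Qed.
Lemma lin_tlift_arg (f : V -> W -> X) (g : U -> V ⊗ W) :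
  bilin f -> linear g -> linear (fun x => tlift f (g x)).
Proof. by move=> /tlift_linear fl gl a x y; rewrite gl fl. Qed.
Lemma lin_tlift_body (f : U -> V -> W -> X) t :
  (forall v w, linear (fun x => f x v w)) -> linear (fun x => tlift (f x) t).
Proof.
by move=> fl a x y; rewrite -tlift_linearl; apply: eq_tlift => v w; exact: fl.
Qed.
Lemma lin_scale (f : U -> V) a : linear f -> linear (fun x => a *: f x).
Proof. by move=> fl b x y; rewrite fl scalerDr !scalerA mulrC. Qed.
Lemma lin_scalel (f : U -> k) (v : V) : scalar f -> linear (fun x => f x *: v).
Proof. by move=> fl b x y; rewrite fl scalerDl scalerA. Qed.
Lemma scal_comp (f : V -> k) (g : U -> V) :
  scalar f -> linear g -> scalar (fun x => f (g x)).
Proof. by move=> fl gl a x y; rewrite gl fl. Qed.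

Lemma tlift_tlift (U1 U2 : lmodType k) (F : V -> W -> X)
    (f : U1 -> U2 -> V ⊗ W) (t : U1 ⊗ U2) :
  bilin F -> tlift F (tlift f t) = (tlet a ⊗ b := t in tlift F (f a b)).
Proof. by move=> /tlift_linear fl; rewrite tlift_comp. Qed.
Lemma exchange_tlift (U1 U2 : lmodType k) (f : V -> W -> U1 -> U2 -> X) t s :
  (tlet a ⊗ b := t in tlet c ⊗ d := s in f a b c d) =
  (tlet c ⊗ d := s in tlet a ⊗ b := t in f a b c d).
Proof.
rewrite tlift_sum.
under eq_bigr do rewrite tlift_sum scaler_sumr.
rewrite exchange_big tlift_sum; apply: eq_bigr => p _.
rewrite tlift_sum scaler_sumr; apply: eq_bigr => q _.
by rewrite !scalerA mulrC.
Qed.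
End LinearComb.

Lemma mul_bilin (k : fieldType) (A : algType k) : bilin ( *%R : A -> A -> A).
Proof.
split=> [x a y z|x a y z]; first by rewrite mulrDr scalerAr.
by rewrite mulrDl scalerAl.
Qed.


Ltac lin_leaf := fail.
Ltac lin := cbv beta;
  lazymatch goal with
  | |- bilin _ => split=> ?; lin
  | |- GRing.linear_for _ (fun x => x) => exact: lin_id
  | |- GRing.linear_for _ (fun x => tlift _ _) => first
    [ apply: lin_tlift_arg; lin | apply: lin_tlift_body=> ? ?; lin ]
  | |- GRing.linear_for _ (fun x => _ ⊗ _) => first
    [ apply: (lin_bilr _ (tens_bilin _ _)); lin
    | apply: (lin_bill _ (tens_bilin _ _)); lin ]
  | |- GRing.linear_for _ (fun x => _ ◁ _) => first
    [ apply: (lin_bilr _ (rmod_bilin ract_module)); lin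
    | apply: (lin_bill _ (rmod_bilin ract_module)); lin ]
  | |- GRing.linear_for _ (fun x => counit _ *: _) => first
    [ apply: (lin_scalel _ counit_linear)
    | apply: (lin_scalel _ (scal_comp counit_linear _)); lin
    | apply: lin_scale; lin ]
  | |- GRing.linear_for _ (fun x => _ *: _) => first
    [ apply: lin_scale; lin
    | match goal with Hl : scalar ?f |- linear (fun x => ?f _ *: _) =>
          apply: (lin_scalel _ (scal_comp Hl _)); lin
      end ]
  | Hl : GRing.linear_for _ ?f |- GRing.linear_for _ ?f => exact Hl
  | Hl : linear ?f |- linear (fun x => ?f _) => apply: (lin_comp Hl); lin
  | |- GRing.linear_for _ (fun x => qclass _) =>
      apply: (lin_comp (qclass_linear _)); lin
  | |- GRing.linear_for _ (tens _) => exact: (proj1 (tens_bilin _ _) _)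
  | |- GRing.linear_for _ (ract _) => exact: (proj1 (rmod_bilin ract_module) _)
  | |- GRing.linear_for _ comul => exact: comul_linear
  | |- GRing.linear_for _ qclass => exact: qclass_linear
  | |- _ => lin_leaf
  end.

Lemma linZ (k : fieldType) (V W : lmodType k) (f : V -> W) a v :
  linear f -> f (a *: v) = a *: f v.
Proof.
move=> lf; have := lf (-1) v v; rewrite !scaleN1r !addNr => f0.
by rewrite -[a *: v]addr0 lf f0 addr0.
Qed.

Lemma lin0 (k : fieldType) (V W : lmodType k) (f : V -> W) :
  linear f -> f 0 = 0.
Proof. by move=> /(linZ 0 0); rewrite !scale0r. Qed.

Lemma scalZ (k : fieldType) (V : lmodType k) (f : V -> k) a v :
  scalar f -> f (a *: v) = a * f v.
Proof. exact: (@linZ k V k^o f). Qed.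

Lemma tensZl (k : fieldType) (V W : lmodType k) a (v : V) (w : W) :
  (a *: v) ⊗ w = a *: (v ⊗ w).
Proof. by rewrite (linZ (f := fun x => x ⊗ w)) //; lin. Qed.

Lemma tensZr (k : fieldType) (V W : lmodType k) a (v : V) (w : W) :
  v ⊗ (a *: w) = a *: (v ⊗ w).
Proof. by rewrite (linZ (f := tens v)) //; lin. Qed.

(* With D = C/I the quotient coalgebra [orbit_coalg C]: C^D, C_D, the cotensor
   product of C with itself over D, and its quotient by W' are [coinv C],
   [coquot C], [cotensor C] and [cotensor_quot C]; the canonical map beta and
   the map it induces on quotients are [can_map] and [can_bar]. *)
Section HopfGalois.
Variables (k : fieldType) (H : hopfAlgType k) (C : modCoalgType H).

Definition orbit_coideal : set C :=
  [set x | exists c (h : H), x = c ◁ h - counit h *: c].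
Definition orbit_coalg : Type := qspace orbit_coideal.
HB.instance Definition _ := GRing.Lmodule.on orbit_coalg.
Local Notation D := orbit_coalg.

Definition orbit_proj (c : C) : D := qclass c.
Local Notation π := orbit_proj.
HB.instance Definition _ :=
  GRing.isLinear.Build k C orbit_coalg *:%R orbit_proj (@qclass_linear _ _ _).

Lemma orbit_projE c (h : H) : π (c ◁ h) = counit h *: π c.
Proof.
rewrite /orbit_proj -linearZ; apply/qclass_eq/span_gen.
by exists c, h.
Qed.

Ltac lin_leaf ::=
  lazymatch goal with
  | |- GRing.linear_for _ orbit_proj => exact: qclass_linear
  | |- GRing.linear_for _ (fun x => π _) =>
      apply: (lin_comp (qclass_linear _)); lin
  end.

Lemma orbit_projP (d : D) : exists c, d = π c.
Proof. by exists (qrepr d); rewrite /orbit_proj qreprK. Qed.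

Definition orbit_comul : D -> D ⊗ D :=
  qlift (fun c : C => tlet a ⊗ b := comul c in π a ⊗ π b).
Definition orbit_counit : D -> k := qlift (counit : C -> k).

Lemma orbit_comulE c :
  orbit_comul (π c) = tlet a ⊗ b := comul c in π a ⊗ π b.
Proof.
have lB : bilin (fun a b : C => π a ⊗ π b) by lin.
rewrite /orbit_comul qliftE //; first by lin.
move=> _ [c' [h ->]].
pose F c := tlet a ⊗ b := comul c in π a ⊗ π b.
have Fl : linear F by rewrite /F; lin.
suff E : F (c' ◁ h) = counit h *: F c'.
  by rewrite -/(F _) addrC -scaleNr Fl E scaleNr addNr.
rewrite {1}/F comul_ract tlift_tlift // /F.
rewrite [RHS](tlift_comp (g := fun y => counit h *: y)); last by lin.
apply: eq_tlift => a b; rewrite tlift_tlift //.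
rewrite -[in RHS](counitl h) (tlift_comp (g := fun y => counit y *: (π a ⊗ π b)));
  last by lin.
apply: eq_tlift => h1 h2; rewrite tlift_tens // !orbit_projE.
rewrite tensZl tensZr (scalZ (f := counit)) ?scalerA; last exact: counit_linear.
by rewrite mulrC.
Qed.

Lemma orbit_comul_linear : linear orbit_comul.
Proof.
move=> a d e; have [[c ->] [c' ->]] := (orbit_projP d, orbit_projP e).
have -> : a *: π c + π c' = π (a *: c + c') by rewrite -[RHS]/(qclass _) qclass_linear.
have Fl : linear (fun c : C => tlet a ⊗ b := comul c in π a ⊗ π b) by lin.
by rewrite !orbit_comulE; exact: Fl.
Qed.

Lemma orbit_counitE c : orbit_counit (π c) = counit c.
Proof.
rewrite /orbit_counit (qliftE (U := k^o)) //; first exact: counit_linear.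
move=> _ [c' [h ->]]; rewrite linearB linearZ /= counit_ract mulrC subrr //.
Qed.

Lemma orbit_counit_linear : scalar orbit_counit.
Proof.
move=> a d e; have [[c ->] [c' ->]] := (orbit_projP d, orbit_projP e).
have -> : a *: π c + π c' = π (a *: c + c') by rewrite -[RHS]/(qclass _) qclass_linear.
by rewrite !orbit_counitE; exact: counit_linear.
Qed.

Lemma orbit_comulA d :
  (tlet a ⊗ b := orbit_comul d in tlet a1 ⊗ a2 := orbit_comul a in a1 ⊗ a2 ⊗ b) =
  (tlet a ⊗ b := orbit_comul d in a ⊗ orbit_comul b).
Proof.
have lc := orbit_comul_linear.
have [c ->] := orbit_projP d; rewrite orbit_comulE !tlift_tlift.
- pose P := fun t : (C ⊗ C ⊗ C)%type =>
    tlet a ⊗ bc := t in tlet b ⊗ c := bc in π a ⊗ π b ⊗ π c.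
  have lP : linear P by rewrite /P; lin.
  transitivity (P (tlet a ⊗ b := comul c in tlet a1 ⊗ a2 := comul a in a1 ⊗ a2 ⊗ b)).
    rewrite tlift_comp //; apply: eq_tlift => a b.
    rewrite tlift_comp // tlift_tens; last by lin.
    rewrite orbit_comulE tlift_tlift; last by lin.
    apply: eq_tlift => a1 a2; rewrite tlift_tens; last by lin.
    rewrite /P tlift_tens; last by lin.
    by rewrite tlift_tens //; lin.
  rewrite comulA tlift_comp //; apply: eq_tlift => a b.
  rewrite /P tlift_tens; last by lin.
  rewrite tlift_tens; last by lin.
  rewrite orbit_comulE [RHS](tlift_comp (g := tens (π a))) //; by lin.
- by lin.
- by lin.
Qed.

Lemma orbit_counitl d : (tlet a ⊗ b := orbit_comul d in orbit_counit a *: b) = d.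
Proof.
have lc := orbit_counit_linear.
have [c ->] := orbit_projP d; rewrite orbit_comulE tlift_tlift; last by lin.
rewrite -[in RHS](counitl c) (tlift_comp (g := π)); last exact: linearP.
apply: eq_tlift => a b; rewrite tlift_tens ?orbit_counitE ?linearZ //; by lin.
Qed.

Lemma orbit_counitr d : (tlet a ⊗ b := orbit_comul d in orbit_counit b *: a) = d.
Proof.
have lc := orbit_counit_linear.
have [c ->] := orbit_projP d; rewrite orbit_comulE tlift_tlift; last by lin.
rewrite -[in RHS](counitr c) (tlift_comp (g := π)); last exact: linearP.
apply: eq_tlift => a b; rewrite tlift_tens ?orbit_counitE ?linearZ //; by lin.
Qed.

HB.instance Definition _ := isCoalgebra.Build k orbit_coalg orbit_comul_linear
  orbit_counit_linear orbit_comulA orbit_counitl orbit_counitr.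

Definition lcoact (c : C) : D ⊗ C := tlet a ⊗ b := comul c in π a ⊗ b.
Definition rcoact (c : C) : C ⊗ D := tlet a ⊗ b := comul c in a ⊗ π b.

Lemma lcoact_linear : linear lcoact. Proof. by rewrite /lcoact; lin. Qed.
Lemma rcoact_linear : linear rcoact. Proof. by rewrite /rcoact; lin. Qed.

Definition in_cotensor : {pred C ⊗ C} := fun x =>
  `[< (tlet c ⊗ c' := x in tlet a ⊗ d := rcoact c in a ⊗ d ⊗ c') =
      (tlet c ⊗ c' := x in c ⊗ lcoact c') >].

Lemma in_cotensor_submod : submod_closed in_cotensor.
Proof.
have rl := rcoact_linear; have ll := lcoact_linear.
pose L (x : (C ⊗ C)%type) :=
  tlet c ⊗ c' := x in tlet a ⊗ d := rcoact c in a ⊗ d ⊗ c'.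
pose R (x : (C ⊗ C)%type) := tlet c ⊗ c' := x in c ⊗ lcoact c'.
have Ll : linear L by rewrite /L; lin.
have Rl : linear R by rewrite /R; lin.
split=> [|a u v /asboolP Eu /asboolP Ev]; apply/asboolP.
  by rewrite -/(L 0) -/(R 0) (lin0 Ll) (lin0 Rl).
by rewrite -/(L _) -/(R _) Ll Rl /L Eu Ev.
Qed.
HB.instance Definition _ :=
  GRing.isSubmodClosed.Build k (C ⊗ C)%type in_cotensor in_cotensor_submod.

Definition cotensor : Type := {x : C ⊗ C | x \in in_cotensor}.
HB.instance Definition _ := [isSub of cotensor for @sval _ _].
HB.instance Definition _ := [Choice of cotensor by <:].
HB.instance Definition _ := [SubChoice_isSubLmodule of cotensor by <:].

Lemma in_cotensorP (x : C ⊗ C) : reflect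
  ((tlet c ⊗ c' := x in tlet a ⊗ d := rcoact c in a ⊗ d ⊗ c') =
   (tlet c ⊗ c' := x in c ⊗ lcoact c')) (x \in in_cotensor).
Proof. exact: asboolP. Qed.

Definition can_fun (x : C ⊗ H) : C ⊗ C :=
  tlet c ⊗ h := x in tlet c1 ⊗ c2 := comul c in c1 ⊗ (c2 ◁ h).

Lemma can_fun_linear : linear can_fun. Proof. by rewrite /can_fun; lin. Qed.

Lemma lcoact_ract c (h : H) :
  lcoact (c ◁ h) = tlet a ⊗ b := comul c in π a ⊗ (b ◁ h).
Proof.
rewrite /lcoact comul_ract tlift_tlift; last by lin.
apply: eq_tlift => a b; rewrite tlift_tlift; last by lin.
rewrite -[in RHS](counitl h) (tlift_comp (g := fun y => π a ⊗ (b ◁ y))); last by lin.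
apply: eq_tlift => h1 h2; rewrite tlift_tens; last by lin.
by rewrite orbit_projE tensZl (linZ (f := fun y => π a ⊗ (b ◁ y))) //; lin.
Qed.

Lemma can_fun_cotensor x : can_fun x \in in_cotensor.
Proof.
have rl := rcoact_linear; have ll := lcoact_linear; have cl := can_fun_linear.
apply/in_cotensorP; move: x.
apply: tensor_ext; [by lin|by lin|] => c h.
rewrite /can_fun tlift_tens; last by lin.
pose P (t : (C ⊗ C ⊗ C)%type) :=
  tlet a ⊗ bc := t in tlet b ⊗ c := bc in a ⊗ π b ⊗ (c ◁ h).
have Pl : linear P by rewrite /P; lin.
transitivity (P (tlet a ⊗ b := comul c in tlet a1 ⊗ a2 := comul a in a1 ⊗ a2 ⊗ b)).
  rewrite (tlift_comp (g := P)) // tlift_tlift; last by lin.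
  apply: eq_tlift => a b; rewrite tlift_tens; last by lin.
  rewrite /rcoact tlift_tlift; last by lin.
  rewrite (tlift_comp (g := P)) //; apply: eq_tlift => a1 a2.
  rewrite tlift_tens; last by lin.
  rewrite /P tlift_tens; last by lin.
  by rewrite tlift_tens //; lin.
rewrite comulA (tlift_comp (g := P)) // tlift_tlift; last by lin.
apply: eq_tlift => a b; rewrite tlift_tens; last by lin.
rewrite lcoact_ract /P tlift_tens; last by lin.
by rewrite [RHS](tlift_comp (g := tens a)) //; lin.
Qed.

Definition can_map (x : C ⊗ H) : cotensor := Sub (can_fun x) (can_fun_cotensor x).

Definition hopf_galois : Prop := bijective can_map.

(* For phi in D^*: c1 phi(pi(c2)) and c2 phi(pi(c1)). *)
Definition evalr (phi : {scalar D}) (c : C) : C :=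
  tlet a ⊗ b := comul c in phi (π b) *: a.
Definition evall (phi : {scalar D}) (c : C) : C :=
  tlet a ⊗ b := comul c in phi (π a) *: b.

Lemma evalr_linear phi : linear (evalr phi).
Proof. have pl : scalar phi by exact: linearP. by rewrite /evalr; lin. Qed.
Lemma evall_linear phi : linear (evall phi).
Proof. have pl : scalar phi by exact: linearP. by rewrite /evall; lin. Qed.

Definition in_coinv : {pred C} := fun c =>
  `[< forall phi : {scalar D}, evalr phi c = evall phi c >].

Lemma in_coinv_submod : submod_closed in_coinv.
Proof.
split=> [|a u v /asboolP Eu /asboolP Ev]; apply/asboolP => phi.
  by rewrite (lin0 (evalr_linear phi)) (lin0 (evall_linear phi)).
by rewrite evalr_linear evall_linear Eu Ev.
Qed.
HB.instance Definition _ :=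
  GRing.isSubmodClosed.Build k C in_coinv in_coinv_submod.

Definition coinv : Type := {c : C | c \in in_coinv}.
HB.instance Definition _ := [isSub of coinv for @sval _ _].
HB.instance Definition _ := [Choice of coinv by <:].
HB.instance Definition _ := [SubChoice_isSubLmodule of coinv by <:].

Lemma evalr_ract phi c (h : H) : evalr phi (c ◁ h) = evalr phi c ◁ h.
Proof.
have pl : scalar phi by exact: linearP.
rewrite /evalr comul_ract tlift_tlift; last by lin.
rewrite [RHS](tlift_comp (g := fun y => y ◁ h)); last by lin.
apply: eq_tlift => a b; rewrite tlift_tlift; last by lin.
rewrite -[in RHS](counitr h).
rewrite (tlift_comp (g := fun y => (phi (π b) *: a) ◁ y)); last by lin.
apply: eq_tlift => h1 h2; rewrite tlift_tens; last by lin.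
rewrite orbit_projE (scalZ _ _ pl).
rewrite (linZ (f := fun y => (phi (π b) *: a) ◁ y)); last by lin.
by rewrite (linZ (f := fun y => y ◁ h1)) ?scalerA //; lin.
Qed.

Lemma evall_ract phi c (h : H) : evall phi (c ◁ h) = evall phi c ◁ h.
Proof.
have pl : scalar phi by exact: linearP.
rewrite /evall comul_ract tlift_tlift; last by lin.
rewrite [RHS](tlift_comp (g := fun y => y ◁ h)); last by lin.
apply: eq_tlift => a b; rewrite tlift_tlift; last by lin.
rewrite -[in RHS](counitl h).
rewrite (tlift_comp (g := fun y => (phi (π a) *: b) ◁ y)); last by lin.
apply: eq_tlift => h1 h2; rewrite tlift_tens; last by lin.
rewrite orbit_projE (scalZ _ _ pl).
rewrite (linZ (f := fun y => (phi (π a) *: b) ◁ y)); last by lin.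
by rewrite (linZ (f := fun y => y ◁ h2)) ?scalerA //; lin.
Qed.

Lemma comul_evalr phi c :
  comul (evalr phi c) = tlet a ⊗ b := comul c in a ⊗ evalr phi b.
Proof.
have pl : scalar phi by exact: linearP.
pose P (t : (C ⊗ C ⊗ C)%type) :=
  tlet x ⊗ yz := t in tlet y ⊗ z := yz in phi (π z) *: (x ⊗ y).
have Pl : linear P by rewrite /P; lin.
transitivity (P (tlet a ⊗ b := comul c in tlet a1 ⊗ a2 := comul a in a1 ⊗ a2 ⊗ b)).
  rewrite (tlift_comp (g := P)) // /evalr (tlift_comp (g := comul)); last by lin.
  apply: eq_tlift => a b; rewrite (tlift_comp (g := P)) //.
  rewrite (linZ _ _ comul_linear) -[in LHS](tlift_id (comul a)).
  rewrite (tlift_comp (g := fun y => phi (π b) *: y)); last by lin.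
  apply: eq_tlift => a1 a2; rewrite /P tlift_tens; last by lin.
  by rewrite tlift_tens //; lin.
rewrite comulA (tlift_comp (g := P)) //; apply: eq_tlift => a b.
rewrite /P tlift_tens; last by lin.
rewrite /evalr [RHS](tlift_comp (g := tens a)); last by lin.
by apply: eq_tlift => b1 b2; rewrite tensZr.
Qed.

Lemma comul_evall phi c :
  comul (evall phi c) = tlet a ⊗ b := comul c in evall phi a ⊗ b.
Proof.
have pl : scalar phi by exact: linearP.
pose P (t : (C ⊗ C ⊗ C)%type) :=
  tlet x ⊗ yz := t in tlet y ⊗ z := yz in phi (π x) *: (y ⊗ z).
have Pl : linear P by rewrite /P; lin.
transitivity (P (tlet a ⊗ b := comul c in a ⊗ comul b)).
  rewrite (tlift_comp (g := P)) // /evall (tlift_comp (g := comul)); last by lin.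
  apply: eq_tlift => a b; rewrite (linZ _ _ comul_linear).
  rewrite /P tlift_tens; last by lin.
  rewrite -[in LHS](tlift_id (comul b)).
  by rewrite (tlift_comp (g := fun y => phi (π a) *: y)) //; lin.
rewrite -comulA (tlift_comp (g := P)) //; apply: eq_tlift => a b.
rewrite (tlift_comp (g := P)) // /evall.
rewrite [RHS](tlift_comp (g := fun y => y ⊗ b)); last by lin.
apply: eq_tlift => a1 a2; rewrite /P tlift_tens; last by lin.
by rewrite tlift_tens ?tensZl //; lin.
Qed.

Lemma cotensor_evalr phi (x : C ⊗ C) : x \in in_cotensor ->
  (tlet c ⊗ c' := x in c ⊗ evalr phi c') \in in_cotensor.
Proof.
have el := evalr_linear phi; have rl := rcoact_linear; have ll := lcoact_linear.
move=> /in_cotensorP Ex; apply/in_cotensorP.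
pose P (t : (C ⊗ D ⊗ C)%type) :=
  tlet a ⊗ dc := t in tlet d ⊗ c := dc in a ⊗ d ⊗ evalr phi c.
have Pl : linear P by rewrite /P; lin.
transitivity (P (tlet c ⊗ c' := x in tlet a ⊗ d := rcoact c in a ⊗ d ⊗ c')).
  rewrite (tlift_comp (g := P)) // tlift_tlift; last by lin.
  apply: eq_tlift => c c'; rewrite tlift_tens; last by lin.
  rewrite (tlift_comp (g := P)) //; apply: eq_tlift => a d.
  by rewrite /P tlift_tens; [rewrite tlift_tens //; lin | lin].
rewrite Ex (tlift_comp (g := P)) // tlift_tlift; last by lin.
apply: eq_tlift => c c'; rewrite tlift_tens; last by lin.
rewrite /P tlift_tens; last by lin.
rewrite /lcoact comul_evalr tlift_tlift; last by lin.
rewrite tlift_tlift; last by lin.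
rewrite (tlift_comp (g := tens c)); last by lin.
apply: eq_tlift => a b; rewrite tlift_tens; last by lin.
by rewrite tlift_tens //; lin.
Qed.

Lemma cotensor_evall phi (x : C ⊗ C) : x \in in_cotensor ->
  (tlet c ⊗ c' := x in evall phi c ⊗ c') \in in_cotensor.
Proof.
have el := evall_linear phi; have rl := rcoact_linear; have ll := lcoact_linear.
move=> /in_cotensorP Ex; apply/in_cotensorP.
pose P (t : (C ⊗ D ⊗ C)%type) :=
  tlet a ⊗ dc := t in evall phi a ⊗ dc.
have Pl : linear P by rewrite /P; lin.
transitivity (P (tlet c ⊗ c' := x in tlet a ⊗ d := rcoact c in a ⊗ d ⊗ c')).
  rewrite (tlift_comp (g := P)) // tlift_tlift; last by lin.
  apply: eq_tlift => c c'; rewrite tlift_tens; last by lin.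
  rewrite (tlift_comp (g := P)) //.
  rewrite /rcoact comul_evall tlift_tlift; last by lin.
  rewrite tlift_tlift; last by lin.
  rewrite tlift_tlift; last by lin.
  apply: eq_tlift => a b; rewrite tlift_tens; last by lin.
  rewrite tlift_tens; last by lin.
  rewrite tlift_tens; last by lin.
  by rewrite /P tlift_tens //; lin.
rewrite Ex (tlift_comp (g := P)) // tlift_tlift; last by lin.
apply: eq_tlift => c c'; rewrite tlift_tens; last by lin.
by rewrite /P tlift_tens //; lin.
Qed.

Definition cocommutators : set C :=
  [set x | exists (phi : {scalar D}) c, x = evalr phi c - evall phi c].
Definition coquot : Type := qspace cocommutators.
HB.instance Definition _ := GRing.Lmodule.on coquot.

Definition cotensor_r (phi : {scalar D}) (x : cotensor) : cotensor :=
  Sub (tlet c ⊗ c' := val x in c ⊗ evalr phi c') (cotensor_evalr phi (valP x)).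
Definition cotensor_l (phi : {scalar D}) (x : cotensor) : cotensor :=
  Sub (tlet c ⊗ c' := val x in evall phi c ⊗ c') (cotensor_evall phi (valP x)).

Definition cotensor_cocommutators : set cotensor :=
  [set y | exists (phi : {scalar D}) x, y = cotensor_r phi x - cotensor_l phi x].
Definition cotensor_quot : Type := qspace cotensor_cocommutators.
HB.instance Definition _ := GRing.Lmodule.on cotensor_quot.

Definition cotensor_class (x : cotensor) : cotensor_quot := qclass x.

(* The map induced by [can_map], see [can_barE]. *)
Definition can_bar (x : coquot ⊗ H) : cotensor_quot :=
  tlet q ⊗ h := x in qlift (fun c : C => cotensor_class (can_map (c ⊗ h))) q.

Lemma can_map_linear : linear can_map.
Proof. by move=> a x y; apply: val_inj; rewrite linearP; exact: can_fun_linear. Qed.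

Lemma can_map_r phi c (h : H) :
  can_map (evalr phi c ⊗ h) = cotensor_r phi (can_map (c ⊗ h)).
Proof.
have el := evalr_linear phi.
apply: val_inj; rewrite /= /can_fun !tlift_tens; try by lin.
rewrite comul_evalr tlift_tlift; last by lin.
rewrite tlift_tlift; last by lin.
apply: eq_tlift => a b; rewrite !tlift_tens; try by lin.
by rewrite evalr_ract.
Qed.

Lemma can_map_l phi c (h : H) :
  can_map (evall phi c ⊗ h) = cotensor_l phi (can_map (c ⊗ h)).
Proof.
have el := evall_linear phi.
apply: val_inj; rewrite /= /can_fun !tlift_tens; try by lin.
rewrite comul_evall tlift_tlift; last by lin.
rewrite tlift_tlift; last by lin.
apply: eq_tlift => a b; rewrite tlift_tens; last by lin.
by rewrite tlift_tens //; lin.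
Qed.

Lemma cotensor_class_linear : linear cotensor_class.
Proof. exact: qclass_linear. Qed.

Lemma can_class_linear (h : H) :
  linear (fun c : C => cotensor_class (can_map (c ⊗ h))).
Proof.
have cl := can_map_linear.
by apply: (lin_comp cotensor_class_linear); lin.
Qed.

End HopfGalois.

Section CanBar.
Variables (k : fieldType) (H : hopfAlgType k) (C : modCoalgType H).
Local Notation D := (orbit_coalg C).
Local Notation π := (@orbit_proj k H C).
Local Notation cocommutators := (@cocommutators k H C).
Local Notation coquot := (coquot C).
Local Notation cotensor := (cotensor C).
Local Notation cotensor_cocommutators := (@cotensor_cocommutators k H C).
Local Notation cotensor_quot := (cotensor_quot C).
Local Notation can_bar := (@can_bar k H C).

Lemma cotensor_class0 y :
  cotensor_class y = 0 <-> y \in span cotensor_cocommutators.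
Proof.
rewrite -(lin0 (@cotensor_class_linear k H C)); split=> [/qclass_eq|?]; first by rewrite subr0.
by apply/qclass_eq; rewrite subr0.
Qed.

Lemma cotensor_r_linear phi : linear (@cotensor_r k H C phi).
Proof.
have el := evalr_linear phi.
have L : linear (fun x : (C ⊗ C)%type => tlet c ⊗ c' := x in c ⊗ evalr phi c') by lin.
by move=> a x y; apply: val_inj; rewrite [RHS]linearP;
  rewrite -[LHS]/(tlift _ (val (a *: x + y))) linearP; exact: L.
Qed.

Lemma cotensor_l_linear phi : linear (@cotensor_l k H C phi).
Proof.
have el := evall_linear phi.
have L : linear (fun x : (C ⊗ C)%type => tlet c ⊗ c' := x in evall phi c ⊗ c') by lin.
by move=> a x y; apply: val_inj; rewrite [RHS]linearP;
  rewrite -[LHS]/(tlift _ (val (a *: x + y))) linearP; exact: L.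
Qed.

Lemma can_class_eq0 (h : H) x :
  cocommutators x -> cotensor_class (can_map (x ⊗ h)) = 0.
Proof.
move=> [phi [c ->]].
have lt : linear (fun c : C => can_map (c ⊗ h)).
  by have cl := @can_map_linear k H C; lin.
rewrite addrC -scaleN1r lt can_map_r can_map_l scaleN1r addrC.
apply/cotensor_class0/span_gen.
by exists phi, (can_map (c ⊗ h)).
Qed.

Lemma can_bar_bilin : bilin (fun (q : coquot) (h : H) =>
  qlift (fun c : C => cotensor_class (can_map (c ⊗ h))) q).
Proof.
split=> [q|h]; last first.
  exact: qlift_linear (@can_class_linear k H C h) (@can_class_eq0 h).
have cl := @can_map_linear k H C; rewrite /qlift; cbv beta.
have lt : linear (fun h : H => can_map (qrepr q ⊗ h)) by lin.
exact: (lin_comp (@cotensor_class_linear k H C) lt).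
Qed.

Lemma can_barE (c : C) (h : H) :
  can_bar ((qclass c : coquot) ⊗ h) = cotensor_class (can_map (c ⊗ h)).
Proof.
rewrite /can_bar tlift_tens; last exact: can_bar_bilin.
by rewrite qliftE //; [exact: can_class_linear | exact: can_class_eq0].
Qed.

Lemma can_bar_linear : linear can_bar.
Proof. exact: tlift_linear can_bar_bilin. Qed.

(* The inverse of [can_bar], which is bijective for a Hopf Galois coextension. *)
Definition can_bar_inv (y : cotensor_quot) : (coquot ⊗ H)%type :=
  xget 0 [set x | can_bar x = y].

Lemma can_barK :
  hopf_galois C -> cancel can_bar can_bar_inv /\ cancel can_bar_inv can_bar.
Proof.
move=> bij; have [g gK Kg] := bij.
have cl := @can_map_linear k H C; have bl := can_bar_linear.
have ql := @cotensor_class_linear k H C.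
pose pr (z : (C ⊗ H)%type) := tlet c ⊗ h := z in (qclass c : coquot) ⊗ h.
have prl : linear pr by rewrite /pr; lin.
have prE c h : pr (c ⊗ h) = (qclass c : coquot) ⊗ h by rewrite /pr tlift_tens //; lin.
have pr_surj x : exists z, pr z = x.
  exists (tlift (fun q h => qrepr q ⊗ h) x).
  rewrite (tlift_comp (g := pr)) // -[RHS]tlift_id; apply: eq_tlift => q h.
  by rewrite prE qreprK.
have bar_pr z : can_bar (pr z) = cotensor_class (can_map z).
  move: z; apply: tensor_ext => [||c h].
  - exact: (lin_comp bl prl).
  - exact: (lin_comp ql cl).
  - by rewrite prE can_barE.
have gl : linear g by move=> b s t; rewrite -[RHS]gK cl !Kg.
have pr0 y : spanned cotensor_cocommutators y -> pr (g y) = 0.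
  elim=> [|a u v [phi [x ->]] _ IH]; first by rewrite (lin0 gl) (lin0 prl).
  rewrite gl prl IH addr0.
  suff E : pr (g (cotensor_r phi x)) = pr (g (cotensor_l phi x)).
    by rewrite addrC -scaleN1r gl prl E scaleN1r addNr scaler0.
  have el := evalr_linear phi; have el' := evall_linear phi.
  pose Rr (z : (C ⊗ H)%type) := tlet c ⊗ h := z in evalr phi c ⊗ h.
  pose Rl (z : (C ⊗ H)%type) := tlet c ⊗ h := z in evall phi c ⊗ h.
  have Rrl : linear Rr by rewrite /Rr; lin.
  have Rll : linear Rl by rewrite /Rl; lin.
  have canR z : can_map (Rr z) = cotensor_r phi (can_map z).
    move: z; apply: tensor_ext => [||c h].
    - exact: (lin_comp cl Rrl).
    - exact: (lin_comp (cotensor_r_linear phi) cl).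
    - by rewrite /Rr tlift_tens ?can_map_r //; lin.
  have canL z : can_map (Rl z) = cotensor_l phi (can_map z).
    move: z; apply: tensor_ext => [||c h].
    - exact: (lin_comp cl Rll).
    - exact: (lin_comp (cotensor_l_linear phi) cl).
    - by rewrite /Rl tlift_tens ?can_map_l //; lin.
  rewrite -(Kg x) -canR -canL !gK; move: (g x).
  apply: tensor_ext => [||c h]; [exact: lin_comp prl Rrl|exact: lin_comp prl Rll|].
  rewrite /Rr /Rl !tlift_tens ?prE; try by lin.
  congr (_ ⊗ _); apply/qclass_eq/span_gen.
  by exists phi, c.
have inj : injective can_bar.
  move=> x y Exy; have [[z zx] [w wy]] := (pr_surj x, pr_surj y).
  move: Exy; rewrite -zx -wy !bar_pr => /qclass_eq /spanP /pr0.
  rewrite addrC -scaleN1r gl !gK prl scaleN1r addrC => /eqP.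
  by rewrite subr_eq0 => /eqP.
have sur y : exists x, can_bar x = y.
  exists (pr (g (qrepr y))); rewrite bar_pr Kg; exact: qreprK.
split=> y; rewrite /can_bar_inv.
- by apply: inj; case: xgetP => [x _ //|/(_ y) no]; case: no.
- by case: xgetP => [x _ //|no]; have [x xy] := sur y; case: (no x).
Qed.

Definition counit_bar : coquot -> k := qlift (counit : C -> k).

Lemma counit_barE (c : C) : counit_bar (qclass c) = counit c.
Proof.
rewrite /counit_bar (qliftE (U := k^o)) //; first exact: counit_linear.
move=> _ [phi [c' ->]].
have pl : scalar phi by exact: linearP.
have pil : linear π by exact: qclass_linear.
have cl : linear (counit : C -> k^o) by exact: counit_linear.
rewrite addrC -scaleN1r cl scaleN1r addrC; apply/eqP; rewrite subr_eq0; apply/eqP.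
rewrite (tlift_comp (g := counit : C -> k^o)) //.
rewrite [RHS](tlift_comp (g := counit : C -> k^o)) //.
transitivity (phi (π c') : k^o).
  rewrite -[in RHS](counitl c') (tlift_comp (g := fun y => phi (π y) : k^o)).
    apply: eq_tlift => a b.
    by rewrite (linZ _ _ cl) (linZ _ _ pil) (scalZ _ _ pl) mulrC.
  by move=> a x y; rewrite pil pl.
rewrite -[in LHS](counitr c') (tlift_comp (g := fun y => phi (π y) : k^o)).
  apply: eq_tlift => a b.
    by rewrite (linZ _ _ cl) (linZ _ _ pil) (scalZ _ _ pl) mulrC.
by move=> a x y; rewrite pil pl.
Qed.

Definition kappa (y : cotensor_quot) : H :=
  tlet q ⊗ h := can_bar_inv y in counit_bar q *: h.

(* [is_cyclic c t] holds when t is the element c2 (x) [c3 (x) c1] of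
   C^D (x) (cotensor_quot C): the tensor c2 (x) (c3 (x) c1) of C (x) (C (x) C)
   lies in the subspace C (x) (cotensor C), where it is y, and the image of y
   in C (x) (cotensor_quot C) lies in C^D (x) (cotensor_quot C), where it is t. *)
Definition is_cyclic (c : coinv C) (t : coinv C ⊗ cotensor_quot) : Prop :=
  exists y : C ⊗ cotensor,
    (tlet a ⊗ x := y in a ⊗ (val x : (C ⊗ C)%type)) =
      (tlet c1 ⊗ c23 := comul (val c : C) in
       tlet c2 ⊗ c3 := comul c23 in c2 ⊗ c3 ⊗ c1) /\
    (tlet a ⊗ x := y in a ⊗ cotensor_class x) =
      (tlet b ⊗ q := t in (val b : C) ⊗ q).
End CanBar.

(* Main.v *)
From HB Require Import structures.
Require Import Defs.
From mathcomp Require Import all_boot all_order all_algebra.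
From mathcomp Require Import boolp classical_sets.
From mathcomp Require Import freeg.

(** Write the canonical map as beta(c (x) h) = c1 (x) c2 h, and let c be in C^D.

    The definition of C^D says that c1 (x) pi(c2) = c2 (x) pi(c1), once D^* is
    known to separate the elements of C (x) D. Hence the flipped coproduct
    c2 (x) c1 lies in the cotensor product, and it is beta of a unique element
    of C (x) H, which lies in C^D (x) H because beta intertwines the two
    actions of D^* whose equalizer is C^D. This yields a unique tensor
    rho(c) = h (x) n of H (x) C^D with

        n1 (x) n2 h = c2 (x) c1                                          (1)

    ([coinv_can_onto], where the map h (x) n |-> n1 (x) n2 h is [coinv_can]).

    This rho is the coaction of the statement. Applying the coproduct to the
    left leg of (1) gives n1 (x) beta(n2 (x) h) = c2 (x) (c3 (x) c1), and
    kappa of the class of beta(n2 (x) h) is counit(n2) h, so that kappa turns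
    this tensor into n (x) h ([cyclic_witness]). Passing to the quotient by W'
    is what moves the first leg into C^D ([cyclic_tens_lift]).

    Since [coinv_can] is injective, every SAYD axiom is an identity that may be
    checked after applying it, where (1) takes over:
    - counit and stability are (1) with the counit applied to the right and
      to the left leg;
    - the anti Yetter-Drinfeld condition reads
      n1 h2 (x) n2 h3 S(h4) g h1 = n1 h2 (x) n2 g h1 = c2 h2 (x) c1 h1;
    - coassociativity requires applying beta twice, and both sides become
      c3 (x) c1 (x) c2.

    What remains is linear algebra over a field: maps f (x) id and id (x) f are
    injective when f is, and a tensor all of whose slices lie in a subspace
    comes from that subspace ([tens_mapl_lift]). Both reduce to the existence
    of a linear form that does not vanish at a given nonzero vector. *)

Set Implicit Arguments.
Unset Strict Implicit.
Unset Printing Implicit Defensive.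

Import GRing.Theory.
Local Open Scope ring_scope.

(** * Linear forms on an arbitrary vector space *)

Section LinearExtension.
Variables (k : fieldType) (V W : lmodType k).

(** Zorn's lemma gives a maximal subspace meeting the image of j only in 0; by
    maximality it is a complement of that image, and the retraction is the
    projection along it. *)
Lemma linear_retraction (j : V -> W) :
  linear j -> injective j -> exists2 r : W -> V, linear r & cancel j r.
Proof.
move=> jl ji.
pose P (S : set W) := (forall a u v, S u -> S v -> S (a *: u + v)) /\
                      (forall v, S (j v) -> v = 0).
have [F FP Ft|A [[Acl A0] Amax]] := @Zorn_bigcup W P.
  split=> [a u v [X FX Xu] [Y FY Yv]|v [X FX]]; last by have [_] := FP X FX; apply.
  have [XY|YX] := Ft X Y FX FY.
    by exists Y => //; have [cl _] := FP Y FY; apply: cl => //; exact: XY.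
  by exists X => //; have [cl _] := FP X FX; apply: cl => //; exact: YX.
have jZ a v : j (a *: v) = a *: j v by exact: linZ.
(* The empty set satisfies P, as it must for the empty chain, so that A may
   miss 0. *)
pose S (s : W) := s = 0 \/ A s.
have Scl a u v : S u -> S v -> S (a *: u + v).
  move=> [->|Au] [->|Av].
  - by left; rewrite scaler0 addr0.
  - by right; rewrite scaler0 add0r.
  - by right; rewrite addr0 -[a](subrK 1) scalerDl scale1r; exact: Acl.
  - by right; exact: Acl.
have SZ a u : S u -> S (a *: u).
  by move=> Su; rewrite -[_ *: _]addr0; apply: Scl => //; left.
have S0 v : S (j v) -> v = 0.
  by case=> [|/A0 //]; rewrite -(lin0 jl) => /ji.
(* If x were not a sum, adjoining it to A would contradict maximality. *)
have dec x : exists v, S (x - j v).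
  apply: contrapT => no; pose B : set W := fun y => exists a s, S s /\ y = a *: x + s.
  apply: (Amax B); first split.
  - by move=> u Au; exists 0, u; rewrite scale0r add0r; split=> //; right.
  - move=> E; apply: no; exists 0; rewrite (lin0 jl) subr0.
    by right; apply: E; exists 1, 0; rewrite scale1r addr0; split=> //; left.
  split=> [a u v [b [s [Ss ->]]] [b' [s' [Ss' ->]]]|v [a [s [Ss Ev]]]].
    exists (a * b + b'), (a *: s + s'); split; first exact: Scl.
    by rewrite scalerDr scalerDl scalerA addrACA.
  have [a0|a0] := eqVneq a 0; first by apply: S0; rewrite Ev a0 scale0r add0r.
  case: no; exists (a^-1 *: v); rewrite jZ Ev scalerDr scalerA mulVf // scale1r.
  by rewrite opprD addNKr -scaleNr; exact: SZ.
have uniq x v v' : S (x - j v) -> S (x - j v') -> v = v'.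
  move=> Sv Sv'; apply/eqP; rewrite -subr_eq0; apply/eqP/S0.
  have := Scl (-1) _ _ Sv Sv'; rewrite scaleN1r opprB addrA subrK.
  by rewrite [j v - _]addrC -[- j v']scaleN1r -jl scaleN1r addrC.
have [r rS] := choice dec.
exists r => [a x y|v].
  by apply: (uniq _ _ _ (rS _)); rewrite jl opprD addrACA -scalerBr; exact: Scl.
apply: (uniq _ _ _ (rS _)).
by rewrite (subrr (j v)); left.
Qed.

End LinearExtension.

Lemma scalar_separates (k : fieldType) (W : lmodType k) (w : W) :
  w != 0 -> exists phi : {scalar W}, phi w = 1.
Proof.
move=> w0; pose j (a : k^o) : W := a *: w.
have jl : linear j by move=> a x y; rewrite /j scalerDl scalerA.
have ji : injective j.
  move=> a b /eqP; rewrite -subr_eq0 -scalerBl scaler_eq0 (negPf w0) orbF.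
  by rewrite subr_eq0 => /eqP.
have [r rl rK] := linear_retraction jl ji.
pose R : {scalar W} := HB.pack (r : W -> k) (GRing.isLinear.Build _ _ _ _ r rl).
by exists R; rewrite -[w]scale1r; exact: rK.
Qed.

(** * Exactness of the tensor product over a field *)

Section TensorExactness.
Variable k : fieldType.
Implicit Types U V W : lmodType k.

Definition slice V W (phi : {scalar W}) (t : V ⊗ W) : V :=
  tlet v ⊗ w := t in phi w *: v.

Definition tens_mapl U V W (j : U -> V) (t : U ⊗ W) : V ⊗ W :=
  tlet u ⊗ w := t in j u ⊗ w.
Definition tens_mapr U V W (j : U -> V) (t : W ⊗ U) : W ⊗ V :=
  tlet w ⊗ u := t in w ⊗ j u.
Definition flip V W (t : V ⊗ W) : W ⊗ V := tlet v ⊗ w := t in w ⊗ v.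

Lemma tens_mapl_linear U V W (j : U -> V) : linear j -> linear (@tens_mapl U V W j).
Proof. by move=> jl; rewrite /tens_mapl; lin. Qed.
Lemma tens_mapr_linear U V W (j : U -> V) : linear j -> linear (@tens_mapr U V W j).
Proof. by move=> jl; rewrite /tens_mapr; lin. Qed.
Lemma flip_linear V W : linear (@flip V W).
Proof. by rewrite /flip; lin. Qed.
Lemma slice_linear V W phi : linear (@slice V W phi).
Proof. have pl : scalar phi by exact: linearP. by rewrite /slice; lin. Qed.

Lemma tens_maplE U V W (j : U -> V) u (w : W) :
  linear j -> tens_mapl j (u ⊗ w) = j u ⊗ w.
Proof. by move=> jl; rewrite /tens_mapl tlift_tens //; lin. Qed.
Lemma tens_maprE U V W (j : U -> V) u (w : W) :
  linear j -> tens_mapr j (w ⊗ u) = w ⊗ j u.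
Proof. by move=> jl; rewrite /tens_mapr tlift_tens //; lin. Qed.
Lemma flipE V W (v : V) (w : W) : flip (v ⊗ w) = w ⊗ v.
Proof. by rewrite /flip tlift_tens //; lin. Qed.
Lemma sliceE V W (phi : {scalar W}) (v : V) w : slice phi (v ⊗ w) = phi w *: v.
Proof.
have pl : scalar phi by exact: linearP.
by rewrite /slice tlift_tens //; lin.
Qed.

Lemma flipK V W : cancel (@flip V W) (@flip W V).
Proof.
have fl := flip_linear; apply: tensor_ext => [||v w]; last by rewrite !flipE.
- exact: (lin_comp (@fl _ _) (@fl _ _)).
- exact: lin_id.
Qed.

Lemma tens_sum V W (t : V ⊗ W) :
  exists s : seq (V * W), t = \sum_(p <- s) (p.1 ⊗ p.2).
Proof.
exists (map (fun p => (coeff p (qrepr t) *: p.1, p.2)) (dom (qrepr t))).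
rewrite -[LHS]tlift_id tlift_sum [RHS]big_map.
by apply: eq_bigr => p _; rewrite tensZl.
Qed.

Lemma slice_sum V W phi (s : seq (V * W)) :
  slice phi (\sum_(p <- s) (p.1 ⊗ p.2)) = \sum_(p <- s) phi p.2 *: p.1.
Proof.
have sl : linear (@slice V W phi) by exact: slice_linear.
elim: s => [|p s IH]; first by rewrite !big_nil (lin0 sl).
by rewrite !big_cons -IH -sliceE -[p.1 ⊗ p.2]scale1r sl !scale1r.
Qed.

(** Induction on the number of terms in a sum of pure tensors. If w is the right
    leg of one term and phi w = 1, the slice of t along phi is some j u, and
    subtracting j u (x) w from t removes that term at the cost of changing the
    other right legs. *)
Lemma tens_mapl_lift U V W (j : U -> V) (t : V ⊗ W) : linear j ->
  (forall phi, exists u, slice phi t = j u) -> exists t', tens_mapl j t' = t.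
Proof.
move=> jl; have [s ->] := tens_sum t.
have [n] := ubnP (size s); elim: n s => // n IH [|[v w] s] /=.
  by move=> _ _; exists 0; rewrite big_nil (lin0 (tens_mapl_linear jl)).
move=> lt_n im; have [w0|/scalar_separates [phi phiw]] := eqVneq w 0.
  have vw : v ⊗ w = 0 by rewrite w0 -(scale0r w) tensZr scale0r.
  by move: im; rewrite big_cons /= vw add0r; apply: IH.
have [u Eu] := im phi.
pose s' := map (fun p => (p.1, p.2 - phi p.2 *: w)) s.
have Es : \sum_(p <- (v, w) :: s) (p.1 ⊗ p.2) =
          j u ⊗ w + \sum_(p <- s') (p.1 ⊗ p.2).
  move: Eu; rewrite slice_sum !big_cons big_map /= phiw scale1r => <-.
  have tl := tens_bilin V W; rewrite -(scale1r v) (proj2 tl) !scale1r -addrA; congr (_ + _).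
  elim: s {s' IH lt_n im} => [|p s IH]; first by rewrite !big_nil (lin0 (proj2 tl w)) addr0.
  rewrite !big_cons (proj2 tl) addrACA -IH; congr (_ + _).
  by rewrite -tensZr -[_ *: w]scale1r -[X in X + _]scale1r -(proj1 tl) scale1r addrCA subrr addr0.
have [|phi'|t' Et'] := IH s'; first by rewrite size_map.
  have [u' Eu'] := im phi'; exists (u' - phi' w *: u).
  have sl := slice_linear phi'.
  move: Eu'; rewrite Es -[j u ⊗ w]scale1r sl scale1r sliceE => Eu'.
  by rewrite addrC -scaleNr jl -Eu' scaleNr addKr.
exists (u ⊗ w + t'); rewrite Es -Et' -(tens_maplE u w jl).
by rewrite -{1}[u ⊗ w]scale1r (tens_mapl_linear jl) scale1r.
Qed.

(** This is [tens_mapl_lift] for j = 0. *)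
Lemma slice_inj V W (t t' : V ⊗ W) :
  (forall phi, slice phi t = slice phi t') -> t = t'.
Proof.
move=> E; pose j (v : V) : V := 0.
have jl : linear j by move=> a x y; rewrite /j scaler0 addr0.
have [phi|t0 Et0] := @tens_mapl_lift V V W j (t - t') jl.
  by exists 0; rewrite addrC -scaleN1r slice_linear E scaleN1r addNr.
apply/eqP; rewrite -subr_eq0 -Et0; apply/eqP.
rewrite -[RHS](lin0 (lin_id (U := (V ⊗ W)%type))); move: t0 {Et0}.
apply: tensor_ext => [||v w]; first exact: tens_mapl_linear.
  by move=> a x y; rewrite scaler0 addr0.
by rewrite tens_maplE // /j -(scale0r v) tensZl scale0r.
Qed.

Lemma slice_mapl U V W (j : U -> V) phi (t : U ⊗ W) :
  linear j -> slice phi (tens_mapl j t) = j (slice phi t).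
Proof.
move=> jl; move: t; apply: tensor_ext => [||u w].
- exact: (lin_comp (slice_linear _) (tens_mapl_linear jl)).
- exact: (lin_comp jl (slice_linear _)).
- by rewrite tens_maplE // !sliceE (linZ _ _ jl).
Qed.

Lemma tens_mapl_inj U V W (j : U -> V) :
  linear j -> injective j -> injective (@tens_mapl U V W j).
Proof.
move=> jl ji t t' E; apply: slice_inj => phi.
by apply: ji; rewrite -!slice_mapl // E.
Qed.

Lemma flip_mapr U V W (j : U -> V) (t : W ⊗ U) :
  linear j -> flip (tens_mapr j t) = tens_mapl j (flip t).
Proof.
move=> jl; move: t; apply: tensor_ext => [||w u].
- exact: (lin_comp (@flip_linear _ _) (tens_mapr_linear jl)).
- exact: (lin_comp (tens_mapl_linear jl) (@flip_linear _ _)).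
- by rewrite tens_maprE // !flipE tens_maplE.
Qed.

Lemma flip_mapl U V W (j : U -> V) (t : U ⊗ W) :
  linear j -> flip (tens_mapl j t) = tens_mapr j (flip t).
Proof.
by move=> jl; apply: (can_inj (@flipK _ _)); rewrite flip_mapr // !flipK.
Qed.

Lemma tens_mapl_mapr U V U' V' (f : U -> V) (g : U' -> V') t :
  linear f -> linear g ->
  tens_mapl f (tens_mapr g t) = tens_mapr g (tens_mapl f t).
Proof.
move=> fl gl; move: t; apply: tensor_ext => [||u u'].
- exact: (lin_comp (tens_mapl_linear fl) (tens_mapr_linear gl)).
- exact: (lin_comp (tens_mapr_linear gl) (tens_mapl_linear fl)).
- by rewrite tens_maprE // !tens_maplE // tens_maprE.
Qed.

Lemma tens_mapr_comp U V U' W (f : V -> U') (g : U -> V) (t : W ⊗ U) :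
  linear f -> linear g -> tens_mapr f (tens_mapr g t) = tens_mapr (f \o g) t.
Proof.
move=> fl gl; rewrite /tens_mapr tlift_tlift; last by lin.
by apply: eq_tlift => w u; rewrite tlift_tens //; lin.
Qed.

Lemma tens_mapr_inj U V W (j : U -> V) :
  linear j -> injective j -> injective (@tens_mapr U V W j).
Proof.
move=> jl ji t t' E; apply: (can_inj (@flipK _ _)).
by apply: (tens_mapl_inj jl ji); rewrite -!flip_mapr // E.
Qed.

Definition tens_assoc U V W (t : (U ⊗ V ⊗ W)%type) : ((U ⊗ V)%type ⊗ W)%type :=
  tlet u ⊗ vw := t in tlet v ⊗ w := vw in (u ⊗ v) ⊗ w.
Lemma tens_assoc_linear U V W : linear (@tens_assoc U V W).
Proof. by rewrite /tens_assoc; lin. Qed.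
Lemma tens_assocE U V W (u : U) (v : V) (w : W) :
  tens_assoc (u ⊗ v ⊗ w) = (u ⊗ v) ⊗ w.
Proof. by rewrite /tens_assoc tlift_tens ?tlift_tens //; lin. Qed.

Lemma tens_assoc_inj U V W : injective (@tens_assoc U V W).
Proof.
pose r (t : ((U ⊗ V)%type ⊗ W)%type) : (U ⊗ V ⊗ W)%type :=
  tlet uv ⊗ w := t in tlet u ⊗ v := uv in u ⊗ v ⊗ w.
have rl : linear r by rewrite /r; lin.
have al := @tens_assoc_linear U V W.
apply: (can_inj (g := r)); apply: tensor_ext => [||u vw].
- exact: lin_comp rl al.
- exact: lin_id.
move: vw; apply: tensor_ext => [||v w]; first by lin.
  by lin.
rewrite tens_assocE /r tlift_tens ?tlift_tens //; by lin.
Qed.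
End TensorExactness.

(** * Sweedler calculus *)

(** The constants and the multilinear functions F in the context for which the
    tactic [lin] should recognize linearity in one argument. *)
Ltac lin_leaf ::=
  lazymatch goal with
  | |- GRing.linear_for _ (@orbit_proj _ _ _) => exact: qclass_linear
  | |- GRing.linear_for _ (fun x => orbit_proj _) =>
      apply: (lin_comp (qclass_linear _)); lin
  | |- GRing.linear_for _ antipode => exact: antipode_linear
  | |- GRing.linear_for _ (@flip _ _ _) => exact: flip_linear
  | |- GRing.linear_for _ (fun x => flip _) =>
      apply: (lin_comp (@flip_linear _ _ _)); lin
  | |- GRing.linear_for _ (fun x => comul _) =>
      apply: (lin_comp comul_linear); lin
  | |- GRing.linear_for _ (fun x => antipode _) =>
      apply: (lin_comp antipode_linear); lin
  | |- GRing.linear_for _ (fun x => _ * _) => first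
    [ apply: (lin_bilr _ (mul_bilin _)); lin
    | apply: (lin_bill _ (mul_bilin _)); lin ]
  | H : forall a b, linear (fun x => ?F x a b) |- linear (fun x => ?F x _ _) => exact: H
  | H : forall a b, linear (fun x => ?F a x b) |- linear (fun x => ?F _ x _) => exact: H
  | H : forall a b, linear (fun x => ?F a b x) |- linear (fun x => ?F _ _ x) => exact: H
  | H : forall a b, linear (?F a b) |- linear (?F _ _) => exact: H
  end.

Section Sweedler.
Variable k : fieldType.

(** Coassociativity under an arbitrary trilinear expression, as it is used in
    computations with Sweedler indices. *)
Lemma sweedlerA (C : coalgType k) (U : lmodType k) (F : C -> C -> C -> U) c :
  (forall y z, linear (fun x => F x y z)) ->
  (forall x z, linear (fun y => F x y z)) ->
  (forall x y, linear (fun z => F x y z)) ->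
  (tlet a ⊗ b := comul c in tlet a1 ⊗ a2 := comul a in F a1 a2 b) =
  (tlet a ⊗ b := comul c in tlet b1 ⊗ b2 := comul b in F a b1 b2).
Proof.
move=> F1 F2 F3.
pose P (t : (C ⊗ C ⊗ C)%type) := tlet x ⊗ yz := t in tlet y ⊗ z := yz in F x y z.
have Pl : linear P by rewrite /P; lin.
have PE x y z : P (x ⊗ y ⊗ z) = F x y z.
  by rewrite /P tlift_tens; [rewrite tlift_tens //; lin | lin].
transitivity (P (tlet a ⊗ b := comul c in tlet a1 ⊗ a2 := comul a in a1 ⊗ a2 ⊗ b)).
  rewrite (tlift_comp (g := P)) //; apply: eq_tlift => a b.
  by rewrite (tlift_comp (g := P)) //; apply: eq_tlift => a1 a2; rewrite PE.
rewrite comulA (tlift_comp (g := P)) //; apply: eq_tlift => a b.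
by rewrite /P tlift_tens //; lin.
Qed.

Lemma tlift_comul_ract (H : hopfAlgType k) (C : modCoalgType H) (U : lmodType k)
    (F : C -> C -> U) (c : C) (h : H) : bilin F ->
  (tlet x ⊗ y := comul (c ◁ h) in F x y) =
  (tlet c1 ⊗ c2 := comul c in tlet h1 ⊗ h2 := comul h in F (c1 ◁ h1) (c2 ◁ h2)).
Proof.
move=> FB; rewrite comul_ract tlift_tlift //; apply: eq_tlift => c1 c2.
by rewrite tlift_tlift //; apply: eq_tlift => h1 h2; rewrite tlift_tens.
Qed.

Lemma sweedler_antipode (H : hopfAlgType k) (U : lmodType k) (F : H -> H -> U) h :
  bilin F ->
  (tlet h12 ⊗ h3 := comul h in tlet h1 ⊗ h2 := comul h12 in
     F h1 (h2 * antipode h3)) = F h 1.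
Proof.
move=> [F2 F1].
rewrite (sweedlerA (F := fun x y z => F x (y * antipode z))).
- rewrite -[in RHS](counitr h) (tlift_comp (g := F^~ 1)) //.
  apply: eq_tlift => a b; rewrite (linZ _ _ (F1 1)) -(linZ _ _ (F2 a)) -antipoder.
  by rewrite (tlift_comp (g := F a)).
- by move=> y z; exact: F1.
- by move=> x z; apply: (lin_comp (F2 x)); lin.
- by move=> x y; apply: (lin_comp (F2 x)); lin.
Qed.
End Sweedler.

(** * Coinvariants and the cotensor product *)

Section Coinvariants.
Variables (k : fieldType) (H : hopfAlgType k) (C : modCoalgType H).
Local Notation π := (@orbit_proj k H C).

Lemma coinv_val_linear : linear (val : coinv C -> C).
Proof. exact: linearP. Qed.

Lemma coinvP (c : C) :
  reflect (forall phi, @evalr k H C phi c = evall phi c) (c \in @in_coinv k H C).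
Proof. exact: asboolP. Qed.

Lemma evalr_coinv phi (c : coinv C) : evalr phi (val c) = evall phi (val c).
Proof. by have /coinvP := valP c; apply. Qed.

(** Slicing commutes with [evalr] and [evall] on the first leg, so the slices of
    t are coinvariant and [tens_mapl_lift] applies. *)
Lemma tens_coinv_lift (W : lmodType k) (t : (C ⊗ W)%type) :
  (forall phi, tens_mapl (@evalr k H C phi) t = tens_mapl (@evall k H C phi) t) ->
  exists t' : (coinv C ⊗ W)%type, tens_mapl val t' = t.
Proof.
move=> E; apply: (tens_mapl_lift coinv_val_linear) => psi.
have Ht : slice psi t \in @in_coinv k H C.
  apply/coinvP => phi.
  rewrite -(slice_mapl _ _ (evalr_linear phi)) E slice_mapl //.
  exact: evall_linear.
by exists (Sub (slice psi t) Ht); rewrite SubK.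
Qed.

Lemma rcoact_coinv (c : coinv C) : rcoact (val c) = flip (lcoact (val c)).
Proof.
apply: slice_inj => phi.
have pl : scalar phi by exact: linearP.
transitivity (evalr phi (val c)); [|rewrite evalr_coinv; symmetry];
  rewrite /slice /rcoact /lcoact /flip !tlift_tlift; try by lin.
- by apply: eq_tlift => a b; rewrite tlift_tens //; lin.
- by apply: eq_tlift => a b; rewrite !tlift_tens //; lin.
Qed.

(** Apply a (x) d |-> a2 (x) d (x) a1 to both sides of [rcoact_coinv]. *)
Lemma flip_comul_cotensor (c : coinv C) :
  flip (comul (val c)) \in @in_cotensor k H C.
Proof.
have rl := @rcoact_linear k H C; have ll := @lcoact_linear k H C.
pose G (t : (C ⊗ orbit_coalg C)%type) : (C ⊗ orbit_coalg C ⊗ C)%type :=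
  tlet a ⊗ d := t in tlet a1 ⊗ a2 := comul a in a2 ⊗ d ⊗ a1.
have Gl : linear G by rewrite /G; lin.
apply/in_cotensorP; transitivity (G (rcoact (val c))).
  rewrite /G /rcoact /flip !tlift_tlift; try by lin.
  transitivity (tlet a ⊗ b := comul (val c) in
                tlet b1 ⊗ b2 := comul b in b1 ⊗ π b2 ⊗ a).
    apply: eq_tlift => a b; rewrite tlift_tens; last by lin.
    by rewrite tlift_tlift; [apply: eq_tlift => x y; rewrite tlift_tens //; lin|lin].
  rewrite -(sweedlerA (F := fun x y z => y ⊗ π z ⊗ x)); try by (move=> *; lin).
  by apply: eq_tlift => a b; rewrite tlift_tens //; lin.
rewrite rcoact_coinv /G /lcoact /flip !tlift_tlift; try by lin.
transitivity (tlet a ⊗ b := comul (val c) in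
              tlet b1 ⊗ b2 := comul b in b2 ⊗ π a ⊗ b1).
  apply: eq_tlift => a b; rewrite tlift_tens; last by lin.
  by rewrite !tlift_tens //; lin.
rewrite -(sweedlerA (F := fun x y z => z ⊗ π x ⊗ y)); try by (move=> *; lin).
apply: eq_tlift => a b; rewrite tlift_tens; last by lin.
rewrite [RHS](tlift_comp (g := tens b)) //; last by lin.
Qed.
End Coinvariants.

(** * The map kappa *)

Section Kappa.
Variables (k : fieldType) (H : hopfAlgType k) (C : modCoalgType H).

Lemma counit_bar_linear : scalar (@counit_bar k H C).
Proof.
move=> a p q; rewrite -(qreprK p) -(qreprK q) -qclass_linear !counit_barE.
exact: counit_linear.
Qed.

Lemma can_bar_inv_linear : hopf_galois C -> linear (@can_bar_inv k H C).
Proof.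
move=> /can_barK [canK invK] a p q; apply: (can_inj canK).
by rewrite can_bar_linear !invK.
Qed.

Lemma kappa_bilin : bilin (fun (q : coquot C) (h : H) => counit_bar q *: h).
Proof. by have cl := counit_bar_linear; lin. Qed.

Lemma kappa_linear : hopf_galois C -> linear (@kappa k H C).
Proof.
move=> /can_bar_inv_linear il.
exact: (lin_tlift_arg kappa_bilin il).
Qed.

Lemma kappa_can (c : C) (h : H) : hopf_galois C ->
  kappa (cotensor_class (can_map (c ⊗ h))) = counit c *: h.
Proof.
move=> /can_barK [canK _]; rewrite -can_barE /kappa canK tlift_tens ?counit_barE //.
exact: kappa_bilin.
Qed.
End Kappa.

(** * The canonical map on coinvariants *)

Section CoinvCan.
Variables (k : fieldType) (H : hopfAlgType k) (C : modCoalgType H).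

(** The canonical map beta restricted to C^D, with its arguments in the order of
    the legs of the coaction: h (x) n |-> n1 (x) n2 h. *)
Definition coinv_can (t : H ⊗ coinv C) : C ⊗ C :=
  can_fun (flip (tens_mapr (val : coinv C -> C) t)).

Lemma coinv_can_linear : linear coinv_can.
Proof.
apply: (lin_comp (@can_fun_linear k H C)); apply: (lin_comp (@flip_linear _ _ _)).
exact/tens_mapr_linear/coinv_val_linear.
Qed.

Lemma can_funE (c : C) (h : H) :
  can_fun (c ⊗ h) = tlet a ⊗ b := comul c in a ⊗ (b ◁ h).
Proof. by rewrite /can_fun tlift_tens //; lin. Qed.

Lemma coinv_canE h (n : coinv C) :
  coinv_can (h ⊗ n) = tlet a ⊗ b := comul (val n) in a ⊗ (b ◁ h).
Proof.
by rewrite /coinv_can tens_maprE ?flipE ?can_funE //; exact: coinv_val_linear.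
Qed.

Lemma coinv_can_tlift (U : lmodType k) (F : C -> C -> U) (t : (H ⊗ coinv C)%type) :
  bilin F ->
  tlift F (coinv_can t) =
  tlet h ⊗ n := t in tlet a ⊗ b := comul (val n) in F a (b ◁ h).
Proof.
move=> FB; have jl := coinv_can_linear; have vl := @coinv_val_linear k H C.
have [F2 F1] := FB.
have Fr h : bilin (fun a b => F a (b ◁ h)).
  by split=> x; [apply: (lin_comp (F2 x)); lin | exact: F1].
rewrite -[in LHS](tlift_id t) (tlift_comp (g := coinv_can)) //.
rewrite tlift_tlift //; apply: eq_tlift => h n.
rewrite coinv_canE tlift_tlift //; apply: eq_tlift => a b.
by rewrite tlift_tens.
Qed.

Lemma can_fun_inj : hopf_galois C -> injective (@can_fun k H C).
Proof. by move=> [g gK _] x y E; apply: (can_inj gK); apply: val_inj. Qed.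

Lemma coinv_can_inj : hopf_galois C -> injective coinv_can.
Proof.
move=> /can_fun_inj bi t t' /bi /(can_inj (@flipK _ _ _)).
by apply: tens_mapr_inj; [exact: coinv_val_linear | exact: val_inj].
Qed.

Lemma can_map_evalr phi (z : (C ⊗ H)%type) :
  can_map (tens_mapl (@evalr k H C phi) z) = cotensor_r phi (can_map z).
Proof.
have el := @evalr_linear k H C phi; have cl := @can_map_linear k H C.
move: z; apply: tensor_ext => [||c h].
- exact: (lin_comp cl (tens_mapl_linear el)).
- exact: (lin_comp (cotensor_r_linear phi) cl).
- by rewrite tens_maplE // can_map_r.
Qed.

Lemma can_map_evall phi (z : (C ⊗ H)%type) :
  can_map (tens_mapl (@evall k H C phi) z) = cotensor_l phi (can_map z).
Proof.
have el := @evall_linear k H C phi; have cl := @can_map_linear k H C.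
move: z; apply: tensor_ext => [||c h].
- exact: (lin_comp cl (tens_mapl_linear el)).
- exact: (lin_comp (cotensor_l_linear phi) cl).
- by rewrite tens_maplE // can_map_l.
Qed.

(** Both sides are c1 (x) c3 weighted by phi (pi c2). *)
Lemma evalr_evall_comul phi (c : C) :
  tens_mapl (@evalr k H C phi) (comul c) = tens_mapr (@evall k H C phi) (comul c).
Proof.
have pl : scalar phi by exact: linearP.
transitivity (tlet a ⊗ b := comul c in
              tlet a1 ⊗ a2 := comul a in phi (orbit_proj a2) *: (a1 ⊗ b)).
  apply: eq_tlift => a b; rewrite /evalr (tlift_comp (g := fun y => y ⊗ b)); last by lin.
  by apply: eq_tlift => a1 a2; rewrite tensZl.
rewrite (sweedlerA (F := fun x y z => phi (orbit_proj y) *: (x ⊗ z)));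
  try by (move=> *; lin).
apply: eq_tlift => a b; rewrite /evall (tlift_comp (g := tens a)); last by lin.
by apply: eq_tlift => b1 b2; rewrite tensZr.
Qed.

(** The preimage z of c2 (x) c1 under beta exists by the Galois condition and
    [flip_comul_cotensor]. Applying phi through [evalr] or [evall] to the first
    leg of z amounts to applying it through [evalr] to the second or through
    [evall] to the first leg of c2 (x) c1, and these agree by
    [evalr_evall_comul]. *)
Lemma coinv_can_onto (c : coinv C) : hopf_galois C ->
  exists t, coinv_can t = flip (comul (val c)).
Proof.
move=> [g gK Kg]; pose X : cotensor C := Sub (flip (comul (val c))) (flip_comul_cotensor c).
have [phi|t Et] := @tens_coinv_lift k H C _ (g X).
  rewrite -[LHS]gK -[RHS]gK can_map_evalr can_map_evall Kg; congr g.
  apply: val_inj.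
  rewrite -[LHS]/(tens_mapr (@evalr k H C phi) (flip (comul (val c)))).
  rewrite -[RHS]/(tens_mapl (@evall k H C phi) (flip (comul (val c)))).
  rewrite -flip_mapl ?evalr_evall_comul ?flip_mapr //; first exact: evall_linear.
  exact: evalr_linear.
exists (flip t); rewrite /coinv_can -flip_mapl ?flipK ?Et; last exact: coinv_val_linear.
by rewrite -[LHS]/(val (can_map (g X))) Kg.
Qed.

(** Let N b be the class of beta(b (x) h). By definition of W', N does not
    distinguish [evalr phi b] from [evall phi b]; hence applying [evalr phi] to
    the first leg of n1 (x) N n2 gives the same as replacing n by [evalr phi n],
    and applying [evall phi] the same as replacing n by [evall phi n]. These
    agree for n in C^D. *)
Lemma cyclic_tens_lift (t : (H ⊗ coinv C)%type) :
  exists s : (coinv C ⊗ cotensor_quot C)%type,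
    tens_mapl val s =
    tlet h ⊗ n := t in tlet a ⊗ b := comul (val n) in
      a ⊗ cotensor_class (can_map (b ⊗ h)).
Proof.
have Nl := @can_class_linear k H C; have Nb := @can_bar_bilin k H C.
have vl := @coinv_val_linear k H C.
have ql := @cotensor_class_linear k H C; have cl := @can_map_linear k H C.
apply: tens_coinv_lift => phi.
have rl := @evalr_linear k H C phi; have ll := @evall_linear k H C phi.
rewrite (tlift_comp (g := tens_mapl (@evalr k H C phi))); last exact: tens_mapl_linear.
rewrite [RHS](tlift_comp (g := tens_mapl (@evall k H C phi))); last exact: tens_mapl_linear.
apply: eq_tlift => h n.
pose N (b : C) := cotensor_class (can_map (b ⊗ h)).
rewrite -[tlift _ _]/(tens_mapr N (comul (val n))).
have Nlin : linear N by exact: Nl.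
have NN : N \o evall phi =1 N \o evalr phi.
  move=> b; apply/esym/eqP; rewrite -subr_eq0 -[X in _ - X]scale1r -scaleNr /= addrC.
  rewrite -(Nl h) addrC scaleN1r; apply/eqP/can_class_eq0.
  by exists phi, b.
transitivity (tens_mapr N (comul (evalr phi (val n)))).
  rewrite tens_mapl_mapr // evalr_evall_comul !tens_mapr_comp // comul_evalr.
  rewrite -[X in tens_mapr N X]/(tens_mapr (@evalr k H C phi) (comul (val n))).
  rewrite tens_mapr_comp //; apply: eq_tlift => a b; congr (_ ⊗ _).
  exact: NN.
by rewrite evalr_coinv comul_evall tens_mapl_mapr.
Qed.

(** For t the coaction of c, this computes c2 (x) (c3 (x) c1) and its images under
    the class map and under kappa as images of t itself. *)
Lemma cyclic_witness (c : coinv C) (t : (H ⊗ coinv C)%type) :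
  coinv_can t = flip (comul (val c)) ->
  exists y : (C ⊗ cotensor C)%type,
    [/\ tens_mapr val y =
         (tlet c1 ⊗ c23 := comul (val c : C) in
          tlet c2 ⊗ c3 := comul c23 in c2 ⊗ c3 ⊗ c1),
        tens_mapr (@cotensor_class k H C) y =
          (tlet h ⊗ n := t in tlet a ⊗ b := comul (val n) in
             a ⊗ cotensor_class (can_map (b ⊗ h))) &
        hopf_galois C ->
        (tlet a ⊗ x := y in kappa (cotensor_class x) ⊗ a) = tens_mapr val t].
Proof.
move=> Et; have cl := @can_map_linear k H C; have ql := @cotensor_class_linear k H C.
have vl := @coinv_val_linear k H C.
have cvl : linear (val : cotensor C -> (C ⊗ C)%type) by exact: linearP.
exists (tlet h ⊗ n := t in tlet a ⊗ b := comul (val n) in a ⊗ can_map (b ⊗ h)).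
split.
- rewrite (tlift_comp (g := tens_mapr val)); last exact: tens_mapr_linear.
  transitivity (tlet p ⊗ q := coinv_can t in
                tlet p1 ⊗ p2 := comul p in p1 ⊗ p2 ⊗ q).
    rewrite coinv_can_tlift; last by lin.
    apply: eq_tlift => h n.
    rewrite (tlift_comp (g := tens_mapr val)); last exact: tens_mapr_linear.
    (* Both sides are n1 (x) n2 (x) n3 h. *)
    rewrite (sweedlerA (F := fun x y z => x ⊗ y ⊗ (z ◁ h))); try by (move=> *; lin).
    apply: eq_tlift => a b; rewrite tens_maprE // -[val _]/(can_fun (b ⊗ h)) can_funE.
    by rewrite (tlift_comp (g := tens a)) //; lin.
  rewrite Et /flip tlift_tlift; last by lin.
  by apply: eq_tlift => a b; rewrite tlift_tens //; lin.
- rewrite (tlift_comp (g := tens_mapr _)); last exact: tens_mapr_linear.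
  apply: eq_tlift => h n.
  rewrite (tlift_comp (g := tens_mapr _)); last exact: tens_mapr_linear.
  by apply: eq_tlift => a b; rewrite tens_maprE.
- move=> bij; have kl := kappa_linear bij.
  have Kl : linear (fun x => kappa (@cotensor_class k H C x)) by exact: (lin_comp kl ql).
  rewrite tlift_tlift; last by lin.
  apply: eq_tlift => h n; rewrite tlift_tlift; last by lin.
  rewrite -[in RHS](counitr (val n)) [RHS](tlift_comp (g := tens h)); last by lin.
  apply: eq_tlift => a b; rewrite tlift_tens; last by lin.
  by rewrite kappa_can // tensZl tensZr.
Qed.

Lemma is_cyclic_unique (c : coinv C) t t' :
  is_cyclic c t -> is_cyclic c t' -> t = t'.
Proof.
move=> [y [Ey Et]] [y' [Ey' Et']].
have cvl : linear (val : cotensor C -> (C ⊗ C)%type) by exact: linearP.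
have yy : y = y' by apply: (tens_mapr_inj cvl val_inj); rewrite /tens_mapr Ey Ey'.
apply: (tens_mapl_inj (@coinv_val_linear k H C) val_inj).
by rewrite /tens_mapl -Et -Et' yy.
Qed.
End CoinvCan.

(** * Stable anti Yetter-Drinfeld structure *)

Section SAYDAxioms.
Variables (k : fieldType) (H : hopfAlgType k) (C : modCoalgType H).

Lemma in_coinv_ract (c : coinv C) (h : H) : val c ◁ h \in @in_coinv k H C.
Proof. by apply/coinvP => phi; rewrite evalr_ract evalr_coinv evall_ract. Qed.

Definition coinv_act (c : coinv C) (h : H) : coinv C :=
  Sub (val c ◁ h) (in_coinv_ract c h).

Lemma coinv_actE (c : coinv C) (h : H) : val (coinv_act c h) = val c ◁ h.
Proof. by []. Qed.

Lemma coinv_act_bilin : bilin coinv_act.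
Proof.
have vl := @coinv_val_linear k H C.
have [r2 r1] := rmod_bilin (@ract_module k H C).
by split=> [c a h h'|h a c c']; apply: val_inj; rewrite [RHS]vl /= ?vl ?r2 ?r1.
Qed.

Lemma coinv_act_module : right_module coinv_act.
Proof.
split; first exact: coinv_act_bilin.
- by move=> c; apply: val_inj; rewrite /= (rmod1 ract_module).
- by move=> c g h; apply: val_inj; rewrite /= (rmodM ract_module).
Qed.

Variable rho : coinv C -> (H ⊗ coinv C)%type.
Hypothesis rhoE : forall c, coinv_can (rho c) = flip (comul (val c)).
Hypothesis bij : hopf_galois C.

Let jl := @coinv_can_linear k H C.
Let ji := coinv_can_inj bij.
Let vl := @coinv_val_linear k H C.

(** The defining equation of rho, n1 (x) n2 h = c2 (x) c1, under an arbitrary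
    bilinear expression. *)
Lemma rho_tlift (U : lmodType k) (F : C -> C -> U) (c : coinv C) : bilin F ->
  (tlet h ⊗ n := rho c in tlet a ⊗ b := comul (val n) in F a (b ◁ h)) =
  (tlet c1 ⊗ c2 := comul (val c) in F c2 c1).
Proof.
move=> FB; have [F2 F1] := FB; rewrite -coinv_can_tlift // rhoE /flip tlift_tlift //.
by apply: eq_tlift => a b; rewrite tlift_tens.
Qed.

Lemma rho_linear : linear rho.
Proof.
have fl : linear (fun c : coinv C => flip (comul (val c))) by lin.
by move=> a c c'; apply: ji; rewrite jl !rhoE fl.
Qed.

Lemma rho_counit (c : coinv C) : (tlet h ⊗ n := rho c in counit h *: n) = c.
Proof.
apply: val_inj; rewrite (tlift_comp (g := val)) // -[RHS]counitl.
have FB : bilin (fun a b : C => counit b *: a) by lin.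
rewrite -(rho_tlift c FB); apply: eq_tlift => h n.
rewrite (linZ _ _ vl) -[in LHS](counitr (val n)).
rewrite (tlift_comp (g := fun y => counit h *: y)); last by lin.
by apply: eq_tlift => a b; rewrite counit_ract scalerA mulrC.
Qed.

Lemma rho_stable (c : coinv C) : (tlet h ⊗ n := rho c in coinv_act n h) = c.
Proof.
apply: val_inj; rewrite (tlift_comp (g := val)) // -[RHS]counitr.
have FB : bilin (fun a b : C => counit a *: b) by lin.
rewrite -(rho_tlift c FB); apply: eq_tlift => h n; rewrite coinv_actE.
rewrite -[in LHS](counitl (val n)) (tlift_comp (g := fun y => y ◁ h)); last by lin.
apply: eq_tlift => a b; rewrite (linZ (f := fun y => y ◁ h)) //; by lin.
Qed.

(** Apply h (x) a (x) b |-> a1 (x) a2 h (x) b after [coinv_can] on the last two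
    legs. The left-hand side becomes n1 (x) n2 h1 (x) n3 h2, that is n1 (x) Delta(n2 h),
    and the right-hand side becomes n2 (x) n3 h (x) n1; both are
    c3 (x) c1 (x) c2. *)
Lemma rho_coassoc (c : coinv C) :
  (tlet h ⊗ n := rho c in tlet h1 ⊗ h2 := comul h in h1 ⊗ h2 ⊗ n) =
  (tlet h ⊗ n := rho c in h ⊗ rho n).
Proof.
have rl := rho_linear.
have fil := @can_fun_linear k H C.
pose j (t : (H ⊗ C)%type) := can_fun (flip t).
have jfl : linear j by apply: (lin_comp fil); exact: flip_linear.
have jfi : injective j by move=> x y /(can_fun_inj bij) /(can_inj (@flipK _ _ _)).
have jE h a : j (h ⊗ a) = tlet a1 ⊗ a2 := comul a in a1 ⊗ (a2 ◁ h).
  by rewrite /j flipE can_funE.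
apply: (tens_mapr_inj jl ji); apply: (@tens_assoc_inj k H C C).
apply: (tens_mapl_inj jfl jfi).
pose P t := tens_mapl j (tens_assoc (tens_mapr (@coinv_can k H C) t)).
have Pl : linear P.
  apply: (lin_comp (tens_mapl_linear jfl)); apply: (lin_comp (@tens_assoc_linear _ _ _ _)).
  exact: tens_mapr_linear.
rewrite -![tens_mapl _ _]/(P _) !(tlift_comp (g := P)) //.
transitivity (tlet h ⊗ n := rho c in tlet a ⊗ b := comul (val n) in
              tlet x ⊗ y := comul (b ◁ h) in (a ⊗ x) ⊗ y).
  apply: eq_tlift => h n; rewrite (tlift_comp (g := P)) //.
  transitivity (tlet h1 ⊗ h2 := comul h in
                tlet a ⊗ b := comul (val n) in
                tlet a1 ⊗ a2 := comul a in (a1 ⊗ (a2 ◁ h1)) ⊗ (b ◁ h2)).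
    apply: eq_tlift => h1 h2; rewrite /P tens_maprE // coinv_canE.
    rewrite (tlift_comp (g := tens h1)); last by lin.
    rewrite (tlift_comp (g := @tens_assoc _ _ _ _)); last exact: tens_assoc_linear.
    rewrite (tlift_comp (g := tens_mapl j)); last exact: tens_mapl_linear.
    apply: eq_tlift => a b; rewrite tens_assocE tens_maplE // jE.
    by rewrite (tlift_comp (g := fun y => y ⊗ (b ◁ h2))) //; lin.
  rewrite exchange_tlift.
  under eq_tlift => a b do rewrite exchange_tlift.
  rewrite (sweedlerA (F := fun x y z =>
    tlet h1 ⊗ h2 := comul h in (x ⊗ (y ◁ h1)) ⊗ (z ◁ h2))); try by (move=> *; lin).
  apply: eq_tlift => a b.
  by rewrite (tlift_comul_ract (F := fun x y => (a ⊗ x) ⊗ y)) //; lin.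
rewrite (rho_tlift (F := fun a b => tlet x ⊗ y := comul b in (a ⊗ x) ⊗ y));
  last by lin.
rewrite (sweedlerA (F := fun x y z => (z ⊗ x) ⊗ y)); try by (move=> *; lin).
pose G (p q : C) := tlet x ⊗ y := comul p in (y ⊗ q) ⊗ x.
have GB : bilin G by rewrite /G; lin.
rewrite -[LHS](rho_tlift c GB); apply: eq_tlift => h n.
rewrite /P tens_maprE // rhoE /flip.
rewrite (tlift_comp (g := tens h)); last by lin.
rewrite (tlift_comp (g := @tens_assoc _ _ _ _)); last exact: tens_assoc_linear.
rewrite (tlift_comp (g := tens_mapl j)); last exact: tens_mapl_linear.
rewrite (sweedlerA (F := fun x y z => (y ⊗ (z ◁ h)) ⊗ x)); try by (move=> *; lin).
apply: eq_tlift => a b; rewrite tens_assocE tens_maplE // jE.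
by rewrite (tlift_comp (g := fun y => y ⊗ a)) //; lin.
Qed.

(** After [coinv_can], the right-hand side is n1 h2 (x) n2 h3 S(h4) g h1 and the
    antipode cancels, leaving n1 h2 (x) n2 g h1; by the defining equation of rho
    this is c2 h2 (x) c1 h1, the flipped coproduct of c h. *)
Lemma rho_act (c : coinv C) (h : H) : rho (coinv_act c h) =
  (tlet h1 ⊗ h23 := comul h in tlet h2 ⊗ h3 := comul h23 in
   tlet g ⊗ n := rho c in (antipode h3 * g * h1) ⊗ coinv_act n h2).
Proof.
have rB := rmod_bilin (@ract_module k H C).
apply: ji; rewrite rhoE coinv_actE.
transitivity (tlet h1 ⊗ h2 := comul h in tlet c1 ⊗ c2 := comul (val c) in
              (c2 ◁ h2) ⊗ (c1 ◁ h1)).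
  rewrite /flip (tlift_comul_ract (F := fun x y => y ⊗ x)); last by lin.
  exact: exchange_tlift.
rewrite (tlift_comp (g := @coinv_can k H C)) //; apply: eq_tlift => h1 h23.
rewrite (tlift_comp (g := @coinv_can k H C)) //.
rewrite -(rho_tlift (F := fun a b => (a ◁ h23) ⊗ (b ◁ h1))); last by lin.
under [RHS]eq_tlift => h2 h3 do rewrite (tlift_comp (g := @coinv_can k H C)) //.
rewrite [RHS]exchange_tlift; apply: eq_tlift => g n.
under [RHS]eq_tlift => h2 h3 do [rewrite coinv_canE coinv_actE tlift_comul_ract; last by lin].
rewrite [RHS]exchange_tlift; apply: eq_tlift => a b.
pose F (x y : H) := (a ◁ x) ⊗ (b ◁ (y * g * h1)).
have FB : bilin F by rewrite /F; lin.
transitivity (F h23 1).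
  by rewrite /F mul1r (rmodM ract_module).
rewrite -sweedler_antipode //; apply: eq_tlift => h2 h3; apply: eq_tlift => x y.
by rewrite /F -!(rmodM ract_module) !mulrA.
Qed.

Lemma coinv_SAYD : SAYD coinv_act rho.
Proof.
split; [exact: coinv_act_module | | | exact: rho_stable].
- by split; [exact: rho_linear | exact: rho_coassoc | exact: rho_counit].
- by move=> m h; exact: rho_act.
Qed.

End SAYDAxioms.

Theorem theorem3p8 (k : fieldType) (H : hopfAlgType k) (C : modCoalgType H) :
  hopf_galois C ->
  exists (act : coinv C -> H -> coinv C) (coact : coinv C -> H ⊗ coinv C),
    [/\ forall c h, val (act c h) = val c ◁ h,
        forall c, exists2 t, unique (is_cyclic c) t &
          coact c = tlet b ⊗ q := t in kappa q ⊗ b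
      & SAYD act coact].
Proof.
move=> bij; have [rho rhoE] := choice (fun c => coinv_can_onto c bij).
exists (@coinv_act k H C), rho; split=> [//|c|]; last exact: coinv_SAYD.
have [y [y_cyclic y_class y_kappa]] := cyclic_witness (rhoE c).
have [t Et] := cyclic_tens_lift (rho c).
have tE : is_cyclic c t by exists y; split=> //; rewrite -[RHS]Et in y_class *.
exists t; first by split=> // t'; exact: is_cyclic_unique.
have vl := @coinv_val_linear k H C; have kl := kappa_linear bij.
apply: (tens_mapr_inj vl val_inj); rewrite -(y_kappa bij).
have Kl : bilin (fun (a : C) (q : cotensor_quot C) => kappa q ⊗ a) by lin.
transitivity (tlift (fun a q => kappa q ⊗ a) (tens_mapl (val : coinv C -> C) t)).
  rewrite Et -y_class tlift_tlift //; apply: eq_tlift => a x.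
  by rewrite tlift_tens.
rewrite tlift_tlift // (tlift_comp (g := tens_mapr val)); last exact: tens_mapr_linear.
by apply: eq_tlift => b q; rewrite tlift_tens // tens_maprE.
Qed.
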